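(* Let $F$ be the free pro-$3$ group on two generators $x,y$, let $\sigma:F\to F$ be the automorphism with $\sigma(x)=x^{-1}$, $\sigma(y)=y^{-1}$, let $t=yxyx^{-1}y$ and, for $n\ge 1$, $r_n=x^3y^{-3^n}$. Let $G_n$ be the pro-$3$ group given by the pro-$3$ presentation \[G_n=\langle x,y\mid r_n^{-1}\sigma(r_n),\ t^{-1}\sigma(t)\rangle.\] Then for every $n\ge 1$: (i) $G_n$ is a finite $3$-group of order $3^{3n+2}$; (ii) $G_n$ is nilpotent of class $2n+1$; (iii) $G_n$ has derived length $\lfloor \log_2(3n+3)\rfloor$.
   Context: A pro-$3$ presentation $\langle x,y\mid R\rangle$ denotes the quotient of the free pro-$3$ group on $x,y$ by the closed normal subgroup generated by $R$. *)

(* Defs.v *)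
From HB Require Import structures.
From mathcomp Require Export all_boot all_order all_fingroup all_solvable.
From mathcomp Require Export boolp classical_sets functions cardinality.
From mathcomp Require Export topology.

Set Implicit Arguments.
Unset Strict Implicit.
Unset Printing Implicit Defensive.

Local Open Scope classical_set_scope.
Local Open Scope card_scope.
Local Open Scope quotient_scope.
Local Open Scope group_scope.

(* Qualified: fingroup.v shadows monoid.Group. *)
HB.mixin Record isTopGroup G of monoid.Group G & Topological G := {
  mulg_continuous : continuous (fun z : G * G => z.1 * z.2);
  invg_continuous : continuous (fun z : G => z^-1)
}.

#[short(type="topGroupType")]
HB.structure Definition TopGroup :=
  {G of isTopGroup G & monoid.Group G & Topological G}.

Section Subgroups.
Variable G : groupType.

Definition is_subgroup (A : set G) : Prop :=
  [/\ A 1, forall u v, A u -> A v -> A (u * v) & forall u, A u -> A u^-1].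

Definition is_normal_subgroup (A : set G) : Prop :=
  is_subgroup A /\ forall u g, A u -> A (u ^ g).

Definition left_cosets (A : set G) : set (set G) :=
  range (fun g : G => [set g * u | u in A]).

Record normal_subgroup := NormalSubgroup {
  normal_set : set G;
  normal_setP : is_normal_subgroup normal_set
}.

End Subgroups.

(* The quotient group G / N, as the type of classes for u^-1 * v \in N. *)
Section QuotientGroup.
Variables (G : groupType) (N : normal_subgroup G).

Definition coset_rel : rel G := fun u v => `[< normal_set N (u^-1 * v) >].

Lemma coset_rel_equiv : equiv_class_of coset_rel.
Proof.
have [[N1 NM NV] _] := normal_setP N.
split=> [u|u v|v u w].
- by apply/asboolP; rewrite mulVg.
- by apply/asboolP/asboolP => /NV; rewrite invgM invgK.
- move=> /asboolP uv /asboolP vw; apply/asboolP.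
  by have := NM _ _ uv vw; rewrite mulgA mulgK.
Qed.

Canonical coset_equiv := EquivRelPack coset_rel_equiv.

Definition quotient_group := {eq_quot coset_equiv}.

HB.instance Definition _ := Choice.on quotient_group.
HB.instance Definition _ := EqQuotient.on quotient_group.

(* fingroup.v and prime.v shadow repr and \pi. *)
Local Notation rep := (@generic_quotient.repr _ quotient_group).
Local Notation cls := (\pi_quotient_group).

Definition quot_mul (a b : quotient_group) : quotient_group :=
  cls (rep a * rep b).
Definition quot_one : quotient_group := cls 1.
Definition quot_inv (a : quotient_group) : quotient_group := cls (rep a)^-1.

Lemma quot_eqP (u v : G) :
  (cls u = cls v) <-> normal_set N (u^-1 * v).
Proof. by split=> [/eqmodP/asboolP|h]; [|apply/eqmodP/asboolP]. Qed.

Lemma quot_repr (u : G) : normal_set N (u^-1 * rep (cls u)).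
Proof. by apply/quot_eqP; rewrite reprK. Qed.

Lemma pi_mulg (u v : G) :
  cls (u * v) = quot_mul (cls u) (cls v).
Proof.
have [[N1 NM NV] NJ] := normal_setP N.
apply/quot_eqP; rewrite invgM.
have h := NJ _ (rep (cls v)) (quot_repr u).
have := NM _ _ (quot_repr v) h.
by rewrite /conjg !mulgA mulgK.
Qed.

Lemma pi_invg (u : G) : cls u^-1 = quot_inv (cls u).
Proof.
have [[N1 NM NV] NJ] := normal_setP N.
apply/quot_eqP; rewrite invgK.
have := NV _ (NJ _ (u^-1) (quot_repr u)).
by rewrite /conjg !mulgA invgK mulgV mul1g invgM invgK.
Qed.

Lemma quot_surj (a : quotient_group) : exists u, a = cls u.
Proof. by exists (rep a); rewrite reprK. Qed.

Lemma quot_mulA : associative quot_mul.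
Proof.
move=> a b c; have [u ->] := quot_surj a; have [v ->] := quot_surj b.
have [w ->] := quot_surj c.
by rewrite -(pi_mulg v w) -(pi_mulg u v) -(pi_mulg u) -(pi_mulg _ w) mulgA.
Qed.

Lemma quot_mul1 : left_id quot_one quot_mul.
Proof. by move=> a; have [u ->] := quot_surj a; rewrite -(pi_mulg 1) mul1g. Qed.

Lemma quot_mulg1 : right_id quot_one quot_mul.
Proof. by move=> a; have [u ->] := quot_surj a; rewrite -(pi_mulg u) mulg1. Qed.

Lemma quot_mulV : left_inverse quot_one quot_inv quot_mul.
Proof.
by move=> a; have [u ->] := quot_surj a; rewrite -pi_invg -(pi_mulg _ u) mulVg.
Qed.

Lemma quot_mulgV : right_inverse quot_one quot_inv quot_mul.
Proof.
by move=> a; have [u ->] := quot_surj a; rewrite -pi_invg -(pi_mulg u) mulgV.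
Qed.

HB.instance Definition _ := isGroup.Build quotient_group
  quot_mulA quot_mul1 quot_mulg1 quot_mulV quot_mulgV.

End QuotientGroup.

Section ProPGroups.
Variables (p : nat) (G : topGroupType).

Definition profinite : Prop :=
  [/\ compact [set: G], hausdorff_space G &
      forall B : set G, nbhs (1 : G) B ->
        exists U : set G, [/\ open U, is_subgroup U & U `<=` B]].

Definition pro_p : Prop :=
  profinite /\
  forall U : set G, open U -> is_normal_subgroup U ->
    exists k, left_cosets U #= `I_(p ^ k)%N.

Definition closed_normal_gen (R : set G) : set G :=
  \bigcap_(A in [set A : set G |
      [/\ closed A, is_normal_subgroup A & R `<=` A]]) A.

Lemma closed_normal_genP (R : set G) : is_normal_subgroup (closed_normal_gen R).
Proof.
split; first split.
- by move=> A [_ [[A1 _ _] _] _].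
- move=> u v hu hv A hA; have [_ [[_ AM _] _] _] := hA.
  by apply: AM; [exact: hu|exact: hv].
- by move=> u hu A hA; have [_ [[_ _ AV] _] _] := hA; exact: AV (hu A hA).
- by move=> u g hu A hA; have [_ [_ AJ] _] := hA; exact: AJ (hu A hA).
Qed.

(* For G free pro-p, the group presented by the relators R. *)
Definition presented_group (R : set G) : groupType :=
  quotient_group (NormalSubgroup (closed_normal_genP R)).

End ProPGroups.

Definition topgroup_hom (G H : topGroupType) (f : G -> H) : Prop :=
  {morph f : u v / u * v} /\ continuous f.

Definition free_pro_p2 (p : nat) (F : topGroupType) (x y : F) : Prop :=
  pro_p p F /\
  forall H : topGroupType, pro_p p H -> forall a b : H,
    exists! f : F -> H, [/\ topgroup_hom f, f x = a & f y = b].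

(* The inverse of a continuous automorphism of a compact Hausdorff group is
   automatically continuous. *)
Definition topgroup_aut (G : topGroupType) (f : G -> G) : Prop :=
  topgroup_hom f /\ bijective f.

Definition has_derived_length (gT : finGroupType) (A : {set gT}) (d : nat) :
    Prop :=
  A^`(d) = 1 /\ forall k, (k < d)%N -> A^`(k) <> 1.

Section Relators.
Variables (F : topGroupType) (x y : F) (sigma : F -> F).

Definition tword : F := y * x * y * x^-1 * y.

Definition rword (n : nat) : F := x ^+ 3 * y ^- (3 ^ n)%N.

Definition relators (n : nat) : set F :=
  [set (rword n)^-1 * sigma (rword n); tword^-1 * sigma tword]%classic.

End Relators.

(* Main.v *)
Require Import Defs.
From HB Require Import structures.
From mathcomp Require Import all_algebra.
From mathcomp Require Import fintype finset zify ring.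

(** In a 3-group the relator [r_n^-1 sigma(r_n)] says [x^3 = y^(3^n)], so this
element is central, and with [w = [y, x]] the relator [t^-1 sigma(t)] says
[y^3 = [w, x]] modulo the fourth term [L_4] of the lower central series.
Commutator calculus modulo [L_5] then shows that [L_4] is generated by [w^3]
modulo [L_5]; as cubing maps [L_k] to [L_(k+2)] and commutes with commutators
to leading order, the factors [L_k / L_(k+1)] have order at most 9 ([k] odd) or
3 ([k] even), and the centrality of [y^(3^n)] kills [L_(2n+2)].  Hence any
3-group satisfying the relations has order at most [3^(3n+2)].

This order is attained.  The group of matrices [[a, b], [3c, d]] of determinant
1, with [a = 1] modulo 3 and entries [a, b, c, d] in [Z/3^(n+1)], is generated
by [x = [[1, 1], [-3, -2]]] and [y = theta [[1, 1], [3, 1]]] with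
[2 theta^2 = -1]; they satisfy the second relation, [x^3 = 1], and [y^(3^n)] is
central of order dividing 3.  Twisting by [Z/9] repairs the first relation and
keeps the order and the derived series, which runs through the congruence
filtration at indices 1, 2, 5, 10, 21, ...

Finally, a closed normal subgroup of a free pro-3 group is an intersection of
open normal ones, so the presented group is determined by its finite
3-quotients, all of which are quotients of the model. *)

Set Implicit Arguments.
Unset Strict Implicit.
Unset Printing Implicit Defensive.

(** * The pro-p Iwahori subgroup of SL_2 *)

Section PowerIdeal.
Variables (R : finComUnitRingType) (pi : R).
Local Open Scope ring_scope.
Import GRing.Theory.
Implicit Types (r s : R) (i j N : nat).

Definition pow_ideal i : {pred R} := fun r => [exists s, r == pi ^+ i * s].

Lemma pow_idealP i r :
  reflect (exists s, r = pi ^+ i * s) (r \in pow_ideal i).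
Proof. by apply: (iffP existsP) => -[s /eqP]; exists s => //; apply/eqP. Qed.

Fact pow_ideal_zmod_closed i : zmod_closed (pow_ideal i).
Proof.
split=> [|_ _ /pow_idealP[r ->] /pow_idealP[s ->]]; apply/pow_idealP.
  by exists 0; rewrite mulr0.
by exists (r - s); rewrite mulrBr.
Qed.
HB.instance Definition _ i :=
  GRing.isZmodClosed.Build R (pow_ideal i) (pow_ideal_zmod_closed i).

Lemma mem_pow_ideal i s : pi ^+ i * s \in pow_ideal i.
Proof. by apply/pow_idealP; exists s. Qed.

Lemma exp_pow_ideal i : pi ^+ i \in pow_ideal i.
Proof. by rewrite -[pi ^+ i]mulr1 mem_pow_ideal. Qed.

Lemma pow_ideal0 r : r \in pow_ideal 0.
Proof. by apply/pow_idealP; exists r; rewrite expr0 mul1r. Qed.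

Lemma pow_ideal_leq i j r :
  r \in pow_ideal i -> (j <= i)%N -> r \in pow_ideal j.
Proof.
by move=> /pow_idealP[s ->] /subnKC <-; rewrite exprD -mulrA mem_pow_ideal.
Qed.

Lemma pow_idealM i j r s :
  r \in pow_ideal i -> s \in pow_ideal j -> r * s \in pow_ideal (i + j).
Proof.
move=> /pow_idealP[r' ->] /pow_idealP[s' ->].
by rewrite mulrACA -exprD mem_pow_ideal.
Qed.

Lemma pow_idealS i r : r \in pow_ideal i -> pi * r \in pow_ideal i.+1.
Proof. by rewrite -add1n; apply/pow_idealM/(exp_pow_ideal 1). Qed.

Lemma mulr_pow_ideal1 r : pi * r \in pow_ideal 1.
Proof. exact/pow_idealS/pow_ideal0. Qed.

Lemma pow_idealMl i r s : s \in pow_ideal i -> r * s \in pow_ideal i.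
Proof. exact: pow_idealM (pow_ideal0 r). Qed.

Lemma pow_idealMr i r s : r \in pow_ideal i -> r * s \in pow_ideal i.
Proof. by rewrite mulrC; apply: pow_idealMl. Qed.

Lemma pow_ideal_nil N r : pi ^+ N = 0 -> r \in pow_ideal N -> r = 0.
Proof. by move=> nil_pi /pow_idealP[s ->]; rewrite nil_pi mul0r. Qed.

Lemma unitr_one_plus_nil N r :
  pi ^+ N = 0 -> r \in pow_ideal 1 -> 1 + r \is a GRing.unit.
Proof.
move=> nil_pi /pow_idealP[s ->]; apply/unitrPr.
have := subrX1 (pi * - s) N; rewrite exprMn nil_pi mul0r sub0r.
rewrite -[_ - 1]opprB mulNr => /oppr_inj inv_s; rewrite -[pi ^+ 1]/pi.
by rewrite -[pi * s]opprK -mulrN; eexists; apply/esym/inv_s.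
Qed.

End PowerIdeal.

Section NearOne.
Variable A : pzRingType.
Local Open Scope ring_scope.
Import GRing.Theory.
Implicit Types p q : A.

Lemma mulr_sub1 p q : p * q - 1 = (p - 1) * (q - 1) + ((p - 1) + (q - 1)).
Proof.
by rewrite [(p - 1) * _]mulrBr mulr1 addrA subrK mulrBl mul1r addrA subrK.
Qed.

Lemma mulr_comm_sub1 p q :
  p * q - q * p = (p - 1) * (q - 1) - (q - 1) * (p - 1).
Proof.
have cancel_r (x y z : A) : (x + z) - (y + z) = x - y.
  by rewrite opprD addrACA subrr addr0.
rewrite -[p * q](subrK 1) -[q * p](subrK 1) cancel_r !mulr_sub1.
by rewrite (addrC (q - 1)) cancel_r.
Qed.

Lemma expr3_sub1 p :
  p ^+ 3 - 1 = (p - 1) ^+ 3 + ((p - 1) ^+ 2 + (p - 1)) *+ 3.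
Proof.
rewrite -{1}[p](subrK 1); move: (p - 1) => q.
have -> : (q + 1) ^+ 3 = 1 + (q *+ 3 + q ^+ 2 *+ 3 + q ^+ 3).
  by rewrite exprD1n !big_ord_recr big_ord0 /= add0r -!addrA.
by rewrite [1 + _]addrC addrK [LHS]addrC mulrnDl (addrC (q *+ 3)).
Qed.

End NearOne.

(* [(a, b, c, d)] stands for the matrix [[a, b], [pi c, d]]; the entry [c] is
remembered even when it is not determined by [pi c].  The phantom parameter
[pi] selects the multiplication. *)
Definition iwahori_order (R : finComUnitRingType) (pi : R) : Type :=
  (R * R * R * R)%type.

Section IwahoriOrder.
Variables (R : finComUnitRingType) (pi : R).
Local Open Scope ring_scope.
Import GRing.Theory.
Local Notation O := (iwahori_order pi).
HB.instance Definition _ := Finite.on O.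
HB.instance Definition _ := GRing.Zmodule.on O.
Implicit Types (p q : O) (i j : nat).

Lemma iwo_oppE a b c d : - ((a, b, c, d) : O) = (- a, - b, - c, - d).
Proof. by []. Qed.
Lemma iwo_addE a b c d a' b' c' d' :
  ((a, b, c, d) : O) + (a', b', c', d') =
    (a + a', b + b', c + c', d + d').
Proof. by []. Qed.

Definition iwo_mul p q : O :=
  let: (a, b, c, d) := p in let: (a', b', c', d') := q in
  (a * a' + pi * b * c', a * b' + b * d',
   c * a' + d * c', pi * c * b' + d * d').
Definition iwo_one : O := (1, 0, 0, 1).

Fact iwo_mulA : associative iwo_mul.
Proof.
move=> [[[a b] c] d] [[[a' b'] c'] d'] [[[a'' b''] c''] d''].
by congr (_, _, _, _); ring.
Qed.
Fact iwo_mul1 : left_id iwo_one iwo_mul.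
Proof. by move=> [[[a b] c] d]; congr (_, _, _, _); ring. Qed.
Fact iwo_mulr1 : right_id iwo_one iwo_mul.
Proof. by move=> [[[a b] c] d]; congr (_, _, _, _); ring. Qed.
Fact iwo_mulDl : left_distributive iwo_mul +%R.
Proof.
move=> [[[a b] c] d] [[[a' b'] c'] d'] [[[a'' b''] c''] d''].
by rewrite !iwo_addE; congr (_, _, _, _); ring.
Qed.
Fact iwo_mulDr : right_distributive iwo_mul +%R.
Proof.
move=> [[[a b] c] d] [[[a' b'] c'] d'] [[[a'' b''] c''] d''].
by rewrite !iwo_addE; congr (_, _, _, _); ring.
Qed.
HB.instance Definition _ := GRing.Zmodule_isPzRing.Build O
  iwo_mulA iwo_mul1 iwo_mulr1 iwo_mulDl iwo_mulDr.

Lemma iwo_oneE : 1 = (1, 0, 0, 1) :> O.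
Proof. by []. Qed.
Lemma iwo_mulE a b c d a' b' c' d' :
  ((a, b, c, d) : O) * (a', b', c', d') =
    (a * a' + pi * b * c', a * b' + b * d',
     c * a' + d * c', pi * c * b' + d * d').
Proof. by []. Qed.
Definition iwoE := (iwo_oneE, iwo_oppE, iwo_addE, iwo_mulE).

Definition iwo_det p : R := let: (a, b, c, d) := p in a * d - pi * b * c.
Definition iwo_adj p : O := let: (a, b, c, d) := p in (d, - b, - c, a).

Lemma iwo_detM p q : iwo_det (p * q) = iwo_det p * iwo_det q.
Proof. by case: p q => [[[a b] c] d] [[[a' b'] c'] d'] /=; ring. Qed.

Lemma iwo_adjB1 p : iwo_adj p - 1 = iwo_adj (p - 1).
Proof.
case: p => [[[a b] c] d]; rewrite /= !iwoE /= ?iwoE.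
by congr (_, _, _, _); ring.
Qed.

Lemma iwo_mul_adj p : iwo_det p = 1 -> iwo_adj p * p = 1.
Proof.
case: p => [[[a b] c] d] /= detp; rewrite !iwoE.
by congr (_, _, _, _); rewrite -?detp; ring.
Qed.

Local Notation J := (pow_ideal pi).

(* The powers of the ideal generated by [[0, 1], [pi, 0]]. *)
Definition rad_pow i : {pred O} :=
  fun p => let: (a, b, c, d) := p in
    [&& a \in J (uphalf i), b \in J i./2, c \in J i./2 & d \in J (uphalf i)].

Lemma mem_rad_pow i a b c d :
  (((a, b, c, d) : O) \in rad_pow i) =
  [&& a \in J (uphalf i), b \in J i./2, c \in J i./2 & d \in J (uphalf i)].
Proof. by []. Qed.

Fact rad_pow_zmod_closed i : zmod_closed (rad_pow i).
Proof.
split=> [|[[[a b] c] d] [[[a' b'] c'] d']].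
  by rewrite mem_rad_pow !rpred0.
by move=> /and4P[? ? ? ?] /and4P[? ? ? ?]; apply/and4P; split; apply: rpredB.
Qed.
HB.instance Definition _ i :=
  GRing.isZmodClosed.Build O (rad_pow i) (rad_pow_zmod_closed i).

Lemma rad_pow_leq i j p : p \in rad_pow i -> (j <= i)%N -> p \in rad_pow j.
Proof.
case: p => [[[a b] c] d] /and4P[Ja Jb Jc Jd] le_ji.
have [? ?] : (uphalf j <= uphalf i)%N /\ (j./2 <= i./2)%N by lia.
apply/and4P; split; [move: Ja | move: Jb | move: Jc | move: Jd];
  by move/pow_ideal_leq; apply.
Qed.

Lemma rad_powM i j p q :
  p \in rad_pow i -> q \in rad_pow j -> p * q \in rad_pow (i + j).
Proof.
case: p q => [[[a b] c] d] [[[a' b'] c'] d'].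
move=> /and4P[Ja Jb Jc Jd] /and4P[Ja' Jb' Jc' Jd'].
apply/and4P; split; apply: rpredD.
- by apply: pow_ideal_leq (pow_idealM Ja Ja') _; lia.
- by apply: pow_ideal_leq (pow_idealM (pow_idealS Jb) Jc') _; lia.
- by apply: pow_ideal_leq (pow_idealM Ja Jb') _; lia.
- by apply: pow_ideal_leq (pow_idealM Jb Jd') _; lia.
- by apply: pow_ideal_leq (pow_idealM Jc Ja') _; lia.
- by apply: pow_ideal_leq (pow_idealM Jd Jc') _; lia.
- by apply: pow_ideal_leq (pow_idealM (pow_idealS Jc) Jb') _; lia.
- by apply: pow_ideal_leq (pow_idealM Jd Jd') _; lia.
Qed.

Lemma rad_pow_three : 3 \in J 1 -> (3 : O) \in rad_pow 2.
Proof.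
move=> J3; rewrite -[3 : O]/(1 + (1 + 1)) !iwoE mem_rad_pow !addr0 !rpred0.
by apply/andP; split.
Qed.

Lemma rad_pow0 p : p \in rad_pow 0.
Proof. by case: p => [[[a b] c] d]; rewrite mem_rad_pow !pow_ideal0. Qed.

Lemma rad_pow_adj i p : p \in rad_pow i -> iwo_adj p \in rad_pow i.
Proof.
case: p => [[[a b] c] d] /and4P[Ja Jb Jc Jd].
by apply/and4P; rewrite !rpredN.
Qed.

Definition iwahori_pred : {pred O} :=
  fun p => (iwo_det p == 1) && (p - 1 \in rad_pow 1).

Lemma mem_iwahori_pred p :
  (p \in iwahori_pred) = (iwo_det p == 1) && (p - 1 \in rad_pow 1).
Proof. by []. Qed.

Fact iwahori_predM p q :
  p \in iwahori_pred -> q \in iwahori_pred -> p * q \in iwahori_pred.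
Proof.
rewrite !mem_iwahori_pred iwo_detM mulr_sub1.
move=> /andP[/eqP-> Jp] /andP[/eqP-> Jq]; rewrite mulr1 eqxx /=.
apply: rpredD (rpredD Jp Jq).
exact: rad_pow_leq (rad_powM Jp Jq) _.
Qed.

Fact iwahori_pred1 : 1 \in iwahori_pred.
Proof. by rewrite mem_iwahori_pred subrr rpred0 /= mulr1 !mulr0 subr0 eqxx. Qed.

Fact iwahori_pred_adj p : p \in iwahori_pred -> iwo_adj p \in iwahori_pred.
Proof.
rewrite !mem_iwahori_pred iwo_adjB1 => /andP[/eqP detp /rad_pow_adj->].
rewrite andbT -detp.
by case: p {detp} => [[[a b] c] d]; apply/eqP => /=; ring.
Qed.

Record iwahori := Iwahori { iw_val : O; _ : iw_val \in iwahori_pred }.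
HB.instance Definition _ := [isSub for iw_val].
HB.instance Definition _ := [Finite of iwahori by <:].
Implicit Types (u v g : iwahori).

Definition iwahori_mul u v := Iwahori (iwahori_predM (valP u) (valP v)).
Definition iwahori_one := Iwahori iwahori_pred1.
Definition iwahori_inv u := Iwahori (iwahori_pred_adj (valP u)).

Fact iwahori_mulA : associative iwahori_mul.
Proof. by move=> u v w; apply: val_inj; apply: mulrA. Qed.
Fact iwahori_mul1 : left_id iwahori_one iwahori_mul.
Proof. by move=> u; apply: val_inj; apply: mul1r. Qed.
Fact iwahori_mulV : left_inverse iwahori_one iwahori_inv iwahori_mul.
Proof.
by move=> u; apply: val_inj; apply: iwo_mul_adj; have /andP[/eqP] := valP u.
Qed.
HB.instance Definition _ :=
  Finite_isGroup.Build iwahori iwahori_mulA iwahori_mul1 iwahori_mulV.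

Lemma iwo_det_val u : iwo_det (iw_val u) = 1.
Proof. by have /andP[/eqP] := valP u. Qed.
Lemma iw_val_inj : injective iw_val. Proof. exact: val_inj. Qed.
Lemma iw_valM u v : iw_val (u * v)%g = iw_val u * iw_val v. Proof. by []. Qed.
Lemma iw_valV u : iw_val (u^-1)%g = iwo_adj (iw_val u). Proof. by []. Qed.
Lemma iw_valX u k : iw_val (u ^+ k)%g = iw_val u ^+ k.
Proof. by elim: k => // k IHk; rewrite expgS exprS iw_valM IHk. Qed.
Lemma iw_val1 : iw_val (1%g : iwahori) = 1. Proof. by []. Qed.

End IwahoriOrder.

Arguments iwahori_pred {R pi}.

Section CongruenceFiltration.
Variables (R : finComUnitRingType) (pi : R).
Local Open Scope ring_scope.
Import GRing.Theory.
Implicit Types i j k l N : nat.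
Local Notation J := (pow_ideal pi).
Local Notation S := (iwahori pi).
Implicit Types (u v g : S).

Definition cong_subg i : {set S} := [set u : S | iw_val u - 1 \in rad_pow i].

Lemma mem_cong i u : (u \in cong_subg i) = (iw_val u - 1 \in rad_pow i).
Proof. by rewrite inE. Qed.

Fact cong_group_set i : group_set (cong_subg i).
Proof.
apply/group_setP; split=> [|u v]; rewrite !mem_cong.
  by rewrite subrr rpred0.
rewrite iw_valM mulr_sub1 => Ju Jv; apply: rpredD (rpredD Ju Jv).
by apply: rad_pow_leq (rad_powM Ju Jv) _; lia.
Qed.
Canonical cong_group i := Group (cong_group_set i).

Lemma cong_leq i j u : u \in cong_subg i -> (j <= i)%N -> u \in cong_subg j.
Proof. by rewrite !mem_cong; apply: rad_pow_leq. Qed.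

Lemma cong1 u : u \in cong_subg 1.
Proof. by rewrite mem_cong; have /andP[] := valP u. Qed.

Lemma cong_nil N u : pi ^+ N = 0 -> u \in cong_subg (N.*2) -> u = 1%g.
Proof.
move=> nil_pi; rewrite mem_cong => Ju; apply/iw_val_inj/eqP; rewrite -subr_eq0.
move: Ju; case: (iw_val u - 1) => [[[a b] c] d].
rewrite mem_rad_pow uphalf_double doubleK => /and4P[].
by do 4![move=> /(pow_ideal_nil nil_pi)->].
Qed.

Lemma mulVg_cong i u g :
  iw_val u - iw_val g \in rad_pow i -> (g^-1 * u)%g \in cong_subg i.
Proof.
have -> : iw_val u = iw_val g * iw_val (g^-1 * u)%g by rewrite -iw_valM mulKVg.
move=> Ju; rewrite mem_cong; set h := iw_val (_ * u)%g in Ju *.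
have -> : h - 1 = iw_val (g^-1)%g * (iw_val g * h - iw_val g).
  by rewrite mulrBr mulrA -iw_valM mulVg mul1r.
exact: rad_powM (rad_pow0 _) Ju.
Qed.

Lemma cong_comm i j u v :
  u \in cong_subg i -> v \in cong_subg j -> [~ u, v]%g \in cong_subg (i + j).
Proof.
have -> : [~ u, v]%g = ((v * u)^-1 * (u * v))%g.
  by rewrite /commg /conjg invgM !mulgA.
rewrite !mem_cong => Ju Jv; rewrite -mem_cong; apply: mulVg_cong.
rewrite !iw_valM mulr_comm_sub1.
by apply: rpredB; [|rewrite addnC]; apply: rad_powM.
Qed.

Lemma commute_cong N i u v :
  pi ^+ N = 0 -> (N.*2 <= i.+1)%N -> u \in cong_subg i -> commute u v.
Proof.
move=> nil_pi le_Ni /cong_comm/(_ (cong1 v)); rewrite addn1.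
by move=> /cong_leq/(_ le_Ni)/(cong_nil nil_pi)/eqP/commgP.
Qed.

Lemma cong_cube i u :
  3 \in J 1 -> (0 < i)%N -> u \in cong_subg i -> (u ^+ 3)%g \in cong_subg i.+2.
Proof.
move=> /rad_pow_three J3 i_gt0; rewrite !mem_cong iw_valX expr3_sub1.
set p := iw_val u - 1 => Jp; have Jpp := rad_powM Jp Jp.
apply: rpredD; first by apply: rad_pow_leq (rad_powM Jp Jpp) _; lia.
have Jsum : p ^+ 2 + p \in rad_pow i.
  by apply: rpredD Jp; apply: rad_pow_leq Jpp _; lia.
by rewrite -mulr_natl; apply: (rad_powM J3 Jsum).
Qed.

Lemma iw_valM_approx u v :
  iw_val (u * v)%g - 1 - ((iw_val u - 1) + (iw_val v - 1)) \in rad_pow 2.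
Proof.
rewrite iw_valM mulr_sub1 addrK.
by apply: (@rad_powM _ _ 1 1); rewrite -mem_cong cong1.
Qed.

Lemma iw_valX_approx u k :
  iw_val (u ^+ k)%g - 1 - (iw_val u - 1) *+ k \in rad_pow 2.
Proof.
elim: k => [|k IHk]; first by rewrite subrr subr0 rpred0.
rewrite expgS mulrS -(subrKA (iw_val u - 1 + (iw_val (u ^+ k)%g - 1))).
apply: rpredD; first exact: iw_valM_approx.
by rewrite opprD addrACA subrr add0r.
Qed.

Lemma iw_valXX_approx u v k l :
  iw_val (u ^+ k * v ^+ l)%g - 1 -
    ((iw_val u - 1) *+ k + (iw_val v - 1) *+ l) \in rad_pow 2.
Proof.
rewrite -(subrKA (iw_val (u ^+ k)%g - 1 + (iw_val (v ^+ l)%g - 1))).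
apply: rpredD; first exact: iw_valM_approx.
by rewrite opprD addrACA; apply: rpredD; apply: iw_valX_approx.
Qed.

End CongruenceFiltration.

(* The [d]-th derived subgroup is the term of index [der_index d] of the
congruence filtration: 1, 2, 5, 10, 21, ... *)
Definition next_der_index m : nat := if odd m then m.*2 else m.*2.+1.
Definition der_index d : nat := iter d next_der_index 1.

Lemma odd_der_index d : odd (der_index d) = ~~ odd d.
Proof.
elim: d => //= d; rewrite /next_der_index => ->.
by case: (odd d); rewrite /= ?odd_double.
Qed.

Lemma der_indexE d : (3 * der_index d + (odd d).+1 = 2 ^ d.+2)%N.
Proof.
elim: d => // d IHd; rewrite [(2 ^ _)%N]expnS -IHd /=.
rewrite /next_der_index odd_der_index.
by case: (odd d) => /=; lia.
Qed.

Lemma der_index_gt0 d : (0 < der_index d)%N.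
Proof. by have := der_indexE d; have := expn_gt0 2 d; rewrite !expnS; lia. Qed.

Lemma der_index_lt_trunc_log n d :
  (der_index d < n.+1.*2) = (d < trunc_log 2 (3 * n + 3)).
Proof.
have -> : (d < trunc_log 2 (3 * n + 3)) = (2 ^ d.+1 <= 3 * n + 3).
  apply/idP/idP => [lt_d|]; last exact: trunc_log_max.
  apply: leq_trans (trunc_logP (isT : 1 < 2) _); last by rewrite addn3.
  by rewrite leq_exp2l.
by have := der_indexE d; rewrite [(2 ^ _)%N]expnS; case: (odd d) => /=; lia.
Qed.

Section ElementaryMatrices.
Variables (R : finComUnitRingType) (pi : R).
Local Open Scope ring_scope.
Import GRing.Theory.
Implicit Types (i l : nat) (b c s t : R).
Local Notation J := (pow_ideal pi).
Local Notation O := (iwahori_order pi).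
Local Notation S := (iwahori pi).
Implicit Types u : S.

Fact upper_subproof s : ((1, s, 0, 1) : O) \in iwahori_pred.
Proof.
rewrite mem_iwahori_pred !iwoE mem_rad_pow !(oppr0, addr0, subrr).
by rewrite !rpred0 pow_ideal0 /= mulr1 mulr0 subr0 eqxx.
Qed.
Definition upper s : S := Iwahori (upper_subproof s).

Fact lower_subproof s : ((1, 0, s, 1) : O) \in iwahori_pred.
Proof.
rewrite mem_iwahori_pred !iwoE mem_rad_pow !(oppr0, addr0, subrr).
by rewrite !rpred0 pow_ideal0 /= mulr1 mulr0 mul0r subr0 eqxx.
Qed.
Definition lower s : S := Iwahori (lower_subproof s).

Lemma upper_cong i s : s \in J i./2 -> upper s \in cong_subg pi i.
Proof.
move=> Js; rewrite mem_cong !iwoE mem_rad_pow !(oppr0, addr0, subrr).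
by rewrite !rpred0 Js.
Qed.

Lemma lower_cong i s : s \in J i./2 -> lower s \in cong_subg pi i.
Proof.
move=> Js; rewrite mem_cong !iwoE mem_rad_pow !(oppr0, addr0, subrr).
by rewrite !rpred0 Js.
Qed.

Lemma cong_neq1 N i : (i < N.*2)%N -> pi ^+ N.-1 != 0 -> cong_subg pi i != 1%g.
Proof.
move=> lt_iN; apply: contra_neqN => /eqP triv.
have : upper (pi ^+ N.-1) \in cong_subg pi i.
  by apply: upper_cong; apply: pow_ideal_leq (exp_pow_ideal _ _) _; lia.
by rewrite triv => /set1gP/(congr1 (@iw_val _ _))[].
Qed.

Lemma val_comm_upper_lower s t : iw_val [~ upper s, lower t]%g =
  (1 + pi * s * t + pi ^+ 2 * s ^+ 2 * t ^+ 2, pi * s ^+ 2 * t,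
   - (pi * s * t ^+ 2), 1 - pi * s * t).
Proof. by congr (_, _, _, _); ring. Qed.

Lemma val_upper_lower b c :
  iw_val (upper b * lower c)%g = (1 + pi * b * c, b, c, 1).
Proof. by congr (_, _, _, _); ring. Qed.

Lemma cong_odd_approx l u (b := (iw_val u).1.1.2) (c := (iw_val u).1.2) :
    u \in cong_subg pi l.*2.+1 ->
  [/\ b \in J l, c \in J l &
      iw_val u - iw_val (upper b * lower c)%g \in rad_pow l.*2.+2].
Proof.
rewrite {}/b {}/c mem_cong val_upper_lower; case: (iw_val u) => [[[a b] c] d].
rewrite !iwoE !mem_rad_pow /= uphalf_double doubleK !subr0 !subrr !rpred0.
move=> /and4P[Ja Jb Jc Jd]; rewrite Jb Jc Jd andbT; split=> //.
rewrite opprD addrA rpredB // -mulrA.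
by apply: pow_ideal_leq (pow_idealS (pow_idealM Jb Jc)) _; lia.
Qed.

Lemma cong_even_approx l u s t : (0 < l)%N ->
    u \in cong_subg pi l.*2 -> (iw_val u).1.1.1 - 1 = pi * s * t ->
  iw_val u - iw_val [~ upper s, lower t]%g \in rad_pow l.*2.+1.
Proof.
move=> l_gt0; rewrite mem_cong val_comm_upper_lower.
have := iwo_det_val u; case: (iw_val u) => [[[a b] c] d] /= detu.
rewrite !iwoE !mem_rad_pow /= uphalf_double doubleK !subr0.
move=> /and4P[Ja Jb Jc Jd] Da; rewrite Da in Ja; apply/and4P; split.
- have -> : a - (1 + pi * s * t + pi ^+ 2 * s ^+ 2 * t ^+ 2) =
      (a - 1) - pi * s * t - (pi * s * t) * (pi * s * t) by ring.
  rewrite Da subrr sub0r rpredN.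
  by apply: pow_ideal_leq (pow_idealM Ja Ja) _; lia.
- have -> : pi * s ^+ 2 * t = s * (pi * s * t) by ring.
  by rewrite rpredB // pow_idealMl.
- have -> : pi * s * t ^+ 2 = t * (pi * s * t) by ring.
  by rewrite opprK rpredD // pow_idealMl.
have Dbc : pi * (b * c) = a * d - 1 by rewrite -detu; ring.
have -> : d - (1 - pi * s * t) = pi * (b * c) - (a - 1) * (d - 1).
  by rewrite -Da Dbc; ring.
rewrite Da; apply: rpredB.
  by apply: pow_ideal_leq (pow_idealS (pow_idealM Jb Jc)) _; lia.
by apply: pow_ideal_leq (pow_idealM Ja Jd) _; lia.
Qed.

End ElementaryMatrices.

Arguments upper {R pi} s.
Arguments lower {R pi} s.

Section CommutatorsOfCongruence.
Variables (R : finComUnitRingType) (pi : R) (N : nat).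
Local Open Scope ring_scope.
Import GRing.Theory.
Hypothesis nil_pi : pi ^+ N = 0.
Implicit Types (i k l m : nat) (b c r s : R).
Local Notation J := (pow_ideal pi).
Local Notation O := (iwahori_order pi).
Local Notation S := (iwahori pi).
Implicit Types u : S.

Lemma unit_1pi r : 1 + pi * r \is a GRing.unit.
Proof. exact: unitr_one_plus_nil nil_pi (mulr_pow_ideal1 pi r). Qed.

Fact diag_rad i r (e := 1 + pi * r) :
  pi * r \in J (uphalf i) -> ((e, 0, 0, e^-1) : O) - 1 \in rad_pow i.
Proof.
have ue : e \is a GRing.unit := unit_1pi r.
have -> : pi * r = e - 1 by rewrite /e addrC addKr.
move=> Je; rewrite !iwoE mem_rad_pow !(oppr0, addr0) !rpred0 Je /=.
have -> : e^-1 - 1 = - e^-1 * (e - 1).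
  by rewrite mulrBr mulNr mulVr // mulr1 opprK addrC.
exact: pow_idealMl.
Qed.

Fact diag_subproof r (e := 1 + pi * r) :
  ((e, 0, 0, e^-1) : O) \in iwahori_pred.
Proof.
rewrite mem_iwahori_pred diag_rad ?mulr_pow_ideal1 //= mulrV ?unit_1pi //.
by rewrite mulr0 subr0 eqxx.
Qed.
Definition diag r : S := Iwahori (diag_subproof r).

Lemma diag_cong i r : pi * r \in J (uphalf i) -> diag r \in cong_subg pi i.
Proof. by rewrite mem_cong; apply: diag_rad. Qed.

Lemma comm_diag_upper r s (e := 1 + pi * r) :
  [~ diag r, upper s]%g = upper (s * (1 - e ^- 2)).
Proof.
have ue : e \is a GRing.unit := unit_1pi r.
apply: iw_val_inj; rewrite /commg /conjg !iw_valM !iw_valV /= -/e.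
congr (_, _, _, _); rewrite -?exprVn.
- by rewrite -[RHS](mulVr ue); ring.
- by rewrite -[X in s * (X - _)](mulVr ue); ring.
- by ring.
- by rewrite -[RHS](mulVr ue); ring.
Qed.

Lemma comm_diag_lower r s (e := 1 + pi * r) :
  [~ diag r, lower s]%g = lower (s * (1 - e ^+ 2)).
Proof.
have ue : e \is a GRing.unit := unit_1pi r.
apply: iw_val_inj; rewrite /commg /conjg !iw_valM !iw_valV /= -/e.
congr (_, _, _, _).
- by rewrite -[RHS](mulVr ue); ring.
- by ring.
- by rewrite -[X in s * (X - _)](mulVr ue); ring.
- by rewrite -[RHS](mulVr ue); ring.
Qed.

Lemma cong_sub_approx M (A : {group S}) :
    (forall i u, (M <= i)%N -> u \in cong_subg pi i ->
       exists2 g, g \in A & iw_val u - iw_val g \in rad_pow i.+1) ->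
  cong_subg pi M \subset A.
Proof.
move=> approx.
suff lift k i u :
    (M <= i)%N -> (N.*2 <= i + k)%N -> u \in cong_subg pi i -> u \in A.
  by apply/subsetP=> u; apply: (lift (N.*2)) => //; lia.
elim: k i u => [|k IHk] i u le_Mi le_Ni Cu.
  rewrite (cong_nil nil_pi (cong_leq Cu _)) ?group1 //; lia.
have [g Ag /mulVg_cong Cgu] := approx i u le_Mi Cu.
by rewrite -[u](mulKVg g) groupM //; apply: IHk Cgu; lia.
Qed.

Hypothesis unit2 : (2 : R) \is a GRing.unit.

Lemma sqr_sub1_associate k (e := 1 + pi * pi ^+ k) :
  exists2 f, f \is a GRing.unit & e ^+ 2 - 1 = pi ^+ k.+1 * f.
Proof.
exists (2 + pi * pi ^+ k); last by rewrite [pi ^+ k.+1]exprS /e; ring.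
have -> : 2 + pi * pi ^+ k = 2 * (1 + pi * (pi ^+ k * 2^-1)).
  by rewrite mulrDr mulr1; congr (_ + _); rewrite -[LHS](mulrK unit2); ring.
by rewrite unitrM unit2 unit_1pi.
Qed.

Section DiagonalCommutators.
Variables m l : nat.
Hypotheses (m_gt0 : (0 < m)%N) (le_ml : (m <= l)%N).

Let k := (uphalf m).-1.
Let e := 1 + pi * pi ^+ k.

Let diag_m : diag (pi ^+ k) \in cong_subg pi m.
Proof.
by apply: diag_cong; rewrite -exprS prednK ?exp_pow_ideal //; lia.
Qed.

Let factor_sub1 b : b \in J l -> exists2 s, s \in J m./2 & b = s * (e ^+ 2 - 1).
Proof.
have [f uf ->] := sqr_sub1_associate k; move=> /pow_idealP[b' ->].
exists (pi ^+ (l - k.+1) * (b' * f^-1)).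
  by apply: pow_ideal_leq (mem_pow_ideal _ _ _) _; lia.
rewrite -{1}[l](@subnKC k.+1) ?exprD; last by lia.
by rewrite -[b' in LHS](mulrVK uf); ring.
Qed.

Lemma upper_mem_comm b :
  b \in J l -> upper b \in [~: cong_subg pi m, cong_subg pi m]%g.
Proof.
have ue : e \is a GRing.unit := unit_1pi _.
move=> /factor_sub1[s Js ->].
have -> : upper (s * (e ^+ 2 - 1)) =
    [~ diag (pi ^+ k)%R, upper (s * e ^+ 2)%R]%g.
  by rewrite comm_diag_upper !mulrBr !mulr1 mulrK ?unitrX.
by apply: mem_commg => //; apply/upper_cong/pow_idealMr.
Qed.

Lemma lower_mem_comm c :
  c \in J l -> lower c \in [~: cong_subg pi m, cong_subg pi m]%g.
Proof.
move=> /factor_sub1[s Js ->].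
have -> : lower (s * (e ^+ 2 - 1)) = [~ diag (pi ^+ k)%R, lower (- s)%R]%g.
  by rewrite comm_diag_lower mulNr -mulrN opprB.
by apply: mem_commg => //; apply: lower_cong; rewrite rpredN.
Qed.

End DiagonalCommutators.

(* Commutators of diagonal and unipotent matrices reach the off-diagonal (odd)
layers, commutators of opposite unipotent matrices the diagonal (even) ones. *)
Lemma cong_sub_comm m : (0 < m)%N ->
  cong_subg pi (next_der_index m) \subset [~: cong_subg pi m, cong_subg pi m]%g.
Proof.
move=> m_gt0; apply: cong_sub_approx => i u; rewrite /next_der_index => le_Mi.
have [odd_i|even_i] := boolP (odd i).
  have le_m : (m <= i./2)%N by move: le_Mi; case: ifP; lia.
  rewrite -[i]odd_double_half odd_i => /cong_odd_approx[Jb Jc approx].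
  eexists; last exact: approx.
  by apply: groupM; [apply: upper_mem_comm Jb | apply: lower_mem_comm Jc].
have lt_m : (m./2.*2 < i./2)%N by move: le_Mi; case: ifP; lia.
have Di : i = i./2.*2 by rewrite -{1}[i]odd_double_half (negbTE even_i).
rewrite Di; set l := i./2 in Di lt_m * => Cu.
have /pow_idealP[p Dp] : (iw_val u).1.1.1 - 1 \in J l.
  move: Cu; rewrite mem_cong; case: (iw_val u) => [[[a b] c] d].
  by rewrite !iwoE mem_rad_pow uphalf_double => /and4P[].
have fact_p :
    (iw_val u).1.1.1 - 1 = pi * pi ^+ m./2 * (pi ^+ (l.-1 - m./2) * p).
  by rewrite Dp -exprS mulrA -exprD; congr (pi ^+ _ * p); lia.
have l_gt0 : (0 < l)%N by lia.
eexists; last exact: cong_even_approx l_gt0 Cu fact_p.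
apply: mem_commg; first by apply/upper_cong/exp_pow_ideal.
by apply: lower_cong; apply: pow_ideal_leq (mem_pow_ideal _ _ _) _; lia.
Qed.

End CommutatorsOfCongruence.

Section CongruenceDerivedSeries.
Variables (R : finComUnitRingType) (pi : R) (N : nat).
Local Open Scope ring_scope.
Import GRing.Theory.
Hypotheses (nil_pi : pi ^+ N = 0) (unit2 : (2 : R) \is a GRing.unit).
Local Notation S := (iwahori pi).

Lemma cong_sub_der d : cong_subg pi (der_index d) \subset ([set: S]^`(d))%g.
Proof.
elim: d => [|d IHd]; first exact: subsetT.
rewrite dergSn; apply: subset_trans (commgSS IHd IHd).
exact: cong_sub_comm nil_pi unit2 _ (der_index_gt0 d).
Qed.

Lemma iwahori_der_neq1 d :
  pi ^+ N.-1 != 0 -> (der_index d < N.*2)%N -> ([set: S]^`(d) != 1)%g.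
Proof.
move=> nz lt_dN; apply: contra_neq (cong_neq1 lt_dN nz) => triv.
by apply/trivgP; rewrite /= -triv cong_sub_der.
Qed.

Let unitr_near1 a : a - 1 \in pow_ideal pi 1 -> a \is a GRing.unit.
Proof. by move=> /(unitr_one_plus_nil nil_pi); rewrite addrC subrK. Qed.

(* The fourth entry is determined by the determinant. *)
Let coord (u : S) := ((iw_val u - 1).1.1.1, (iw_val u).1.1.2, (iw_val u).1.2).

Let coord_inj : injective coord.
Proof.
move=> u v eq_uv; apply: iw_val_inj.
have := iwo_det_val v; have := iwo_det_val u; have /andP[_] := valP u.
move: eq_uv; rewrite /coord -[val u]/(iw_val u).
case: (iw_val u) (iw_val v) => [[[a b] c] d] [[[a' b'] c'] d'].
rewrite !iwoE mem_rad_pow => -[/addIr <- <- <-] /and4P[/unitr_near1 ua _ _ _].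
move=> /= detu detv; congr (_, _, _, _); apply: (mulrI ua).
by apply: (addIr (- (pi * b * c))); rewrite detu.
Qed.

Let coord_image :
  coord @: [set: S] = setX (setX [set r in pow_ideal pi 1] [set: R]) [set: R].
Proof.
apply/setP=> -[[r b] c]; rewrite !in_setX !inE !andbT; apply/imsetP/idP.
  case=> u _ [-> _ _]; have /andP[_] := valP u; rewrite -[val u]/(iw_val u).
  by case: (iw_val u) => [[[? ?] ?] ?]; rewrite !iwoE mem_rad_pow => /and4P[].
move=> Jr; pose a := r + 1; have Da : a - 1 = r by rewrite addrK.
have ua : a \is a GRing.unit by rewrite unitr_near1 ?Da.
pose d := a^-1 * (1 + pi * b * c).
have in_S : ((a, b, c, d) : iwahori_order pi) \in iwahori_pred.
  rewrite mem_iwahori_pred !iwoE mem_rad_pow !pow_ideal0 Da Jr.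
  rewrite /= mulrA mulrV // mul1r addrK eqxx /=.
  have -> : d - 1 = a^-1 * (pi * (b * c) - r).
    by rewrite -Da -[X in d - X](mulVr ua) /d; ring.
  by rewrite pow_idealMl // rpredB // mulr_pow_ideal1.
by exists (Iwahori in_S); rewrite ?inE // /coord !iwoE Da.
Qed.

Lemma card_iwahori : #|[set: S]| = (#|pow_ideal pi 1| * #|R| * #|R|)%N.
Proof.
by rewrite -(card_imset _ coord_inj) coord_image !cardsX !cardsT cardsE.
Qed.

End CongruenceDerivedSeries.

Section Generators.
Variables (R : finComUnitRingType) (n : nat).
Local Open Scope ring_scope.
Import GRing.Theory.
Hypothesis nil3 : (3 : R) ^+ n.+1 = 0.
Implicit Types (i j k l : nat) (r a b c d : R).
Local Notation J := (pow_ideal (3 : R)).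
Local Notation O := (iwahori_order (3 : R)).
Local Notation S := (iwahori (3 : R)).
Implicit Types (u v g : S).

Lemma unitr2_three_nil : (2 : R) \is a GRing.unit.
Proof.
have := unitr_one_plus_nil nil3 (exp_pow_ideal _ 1).
have -> : 1 + 3 ^+ 1 = 2 * 2 :> R by ring.
by rewrite unitrM andbb.
Qed.

(* Newton iteration: replacing [t] by [t + 2 (2 t^2 + 1)] multiplies the error
[2 t^2 + 1] by an element divisible by 3. *)
Lemma sqrt_neg_half : exists2 t : R, t - 1 \in J 1 & 2 * t ^+ 2 = -1.
Proof.
suff approx k : exists2 t : R, t - 1 \in J 1 & 2 * t ^+ 2 + 1 \in J k.+1.
  have [t t1 /(pow_ideal_nil nil3)/eqP] := approx n.
  by rewrite addr_eq0 => /eqP; exists t.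
elim: k => [|k [t t1 Jerr]].
  exists 1; first by rewrite subrr rpred0.
  by have -> : 2 * 1 ^+ 2 + 1 = 3 ^+ 1 :> R; [ring | apply: exp_pow_ideal].
set err := 2 * t ^+ 2 + 1 in Jerr; exists (t + 2 * err).
  have -> : t + 2 * err - 1 = t - 1 + 2 * err by ring.
  by rewrite rpredD // pow_idealMl // (pow_ideal_leq Jerr).
have -> : 2 * (t + 2 * err) ^+ 2 + 1 =
    err * (3 * 3 + 8 * (t - 1)) + 8 * (err * err) by rewrite /err; ring.
apply: rpredD.
  rewrite -[k.+2]addn1; apply: pow_idealM Jerr _.
  by rewrite rpredD ?mulr_pow_ideal1 // pow_idealMl.
by apply: pow_idealMl; apply: pow_ideal_leq (pow_idealM Jerr Jerr) _; lia.
Qed.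

Fact iwahori_x_subproof : ((1, 1, -1, -2) : O) \in iwahori_pred.
Proof.
rewrite mem_iwahori_pred !iwoE mem_rad_pow !pow_ideal0 subrr rpred0 /=.
have -> : -2 - 1 = - 3 :> R by ring.
by rewrite rpredN (exp_pow_ideal _ 1) andbT; apply/eqP; ring.
Qed.
Definition iwahori_x : S := Iwahori iwahori_x_subproof.

Lemma iwahori_x_cube : (iwahori_x ^+ 3 = 1)%g.
Proof.
apply: iw_val_inj; rewrite !expgS expg0 mulg1 !iw_valM iw_val1.
by congr (_, _, _, _); ring.
Qed.

Variable theta : R.
Hypotheses (theta1 : theta - 1 \in J 1) (theta_sqr : 2 * theta ^+ 2 = -1).

Fact iwahori_y_subproof : ((theta, theta, theta, theta) : O) \in iwahori_pred.
Proof.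
rewrite mem_iwahori_pred !iwoE mem_rad_pow !pow_ideal0 theta1 /= andbT.
by apply/eqP; rewrite -[RHS]opprK -theta_sqr; ring.
Qed.
Definition iwahori_y : S := Iwahori iwahori_y_subproof.

Lemma iwahori_second_relation :
  (iwahori_y * iwahori_x * iwahori_y * iwahori_x^-1 * iwahori_y =
   iwahori_y^-1 * iwahori_x^-1 * iwahori_y^-1 * iwahori_x * iwahori_y^-1)%g.
Proof.
apply: iw_val_inj; rewrite !iw_valM !iw_valV.
by congr (_, _, _, _); ring.
Qed.

Lemma iwahori_y_pow_cong j : (iwahori_y ^+ (3 ^ j))%g \in cong_subg 3 (j.*2.+1).
Proof.
elim: j => [|j IHj]; first exact: cong1.
by rewrite expnSr expgM; apply: cong_cube IHj; rewrite ?(exp_pow_ideal _ 1).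
Qed.

Lemma iwahori_y_pow_central u : commute (iwahori_y ^+ (3 ^ n))%g u.
Proof. by apply: commute_cong nil3 _ (iwahori_y_pow_cong n); lia. Qed.

Lemma iwahori_y_pow_cube : (iwahori_y ^+ (3 ^ n) ^+ 3 = 1)%g.
Proof.
rewrite -expgM -expnSr.
by apply: cong_nil nil3 (cong_leq (iwahori_y_pow_cong _) _); lia.
Qed.

Hypothesis residue3 : forall r, exists i : nat, r - i%:R \in J 1.

Lemma rad_pow2_offdiag (p : O) :
  p \in rad_pow 1 -> p.1.1.2 \in J 1 -> p.1.2 \in J 1 -> p \in rad_pow 2.
Proof.
case: p => [[[a b] c] d]; rewrite !mem_rad_pow => /and4P[Ja _ _ Jd] /= Jb Jc.
by apply/and4P.
Qed.

Lemma gen_iwahori_approx u :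
  exists2 g, g \in <<[set iwahori_x; iwahori_y]>>%g &
    iw_val u - iw_val g \in rad_pow 2.
Proof.
have [i Ji] := residue3 (iw_val u).1.1.2.
have [j Jj] := residue3 (iw_val u).1.2.
pose k := (j + 2 * i)%N; pose l := (2 * (i + j))%N.
exists (iwahori_x ^+ k * iwahori_y ^+ l)%g.
  by rewrite groupM ?groupX // mem_gen // !inE eqxx ?orbT.
have := iw_valXX_approx iwahori_x iwahori_y k l; set g := (_ * _)%g => approx.
set lin := _ *+ k + _ *+ l in approx.
have Dlin : lin =
    (lin.1.1.1, k%:R + theta * l%:R, - (k%:R) + theta * l%:R, lin.2).
  have natmulE m a b c d :
      ((a, b, c, d) : O) *+ m = (a *+ m, b *+ m, c *+ m, d *+ m).
    by elim: m => [|m IHm]; rewrite ?mulr0n // !mulrS IHm iwoE.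
  by rewrite /lin !iwoE /= !natmulE iwoE /=; congr (_, _, _, _); ring.
have -> : iw_val u - iw_val g = (iw_val u - 1 - lin) - (iw_val g - 1 - lin).
  by rewrite opprB subrKA opprB subrKA.
apply: rpredB approx; apply: rad_pow2_offdiag.
- have near1 v : iw_val v - 1 \in rad_pow 1 by rewrite -mem_cong cong1.
  by apply: rpredB => //; apply: rpredD; apply: rpredMn.
- rewrite Dlin; case: (iw_val u) Ji => [[[a b] c] d] /= Ji.
  have -> : b - 0 - (k%:R + theta * l%:R) =
      (b - i%:R) - l%:R * (theta - 1) - 3 * (i%:R + j%:R).
    by rewrite /k /l !(natrD, natrM); ring.
  apply: rpredB (mulr_pow_ideal1 _ _); apply: rpredB Ji _; exact: pow_idealMl.
rewrite Dlin; case: (iw_val u) Jj => [[[a b] c] d] /= Jj.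
have -> : c - 0 - (- (k%:R) + theta * l%:R) = (c - j%:R) - l%:R * (theta - 1).
  by rewrite /k /l !(natrD, natrM); ring.
by apply: rpredB Jj _; apply: pow_idealMl.
Qed.

Lemma gen_iwahori :
  (3.-group [set: S])%g -> <<[set iwahori_x; iwahori_y]>>%g = [set: S].
Proof.
move=> pS; apply: Phi_nongen; apply/eqP; rewrite eqEsubset subsetT /=.
apply/subsetP=> u _; have [g gen_g /mulVg_cong Cgu] := gen_iwahori_approx u.
rewrite -[u](mulKVg g); apply: groupM.
  by apply: subsetP gen_g; rewrite genS ?subsetUr.
have /subsetP/(_ _ Cgu) der_gu := cong_sub_der nil3 unitr2_three_nil 1.
by rewrite mem_gen // in_setU (Phi_joing pS) mem_gen // in_setU der_gu.
Qed.

End Generators.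

Section IntegersModPowerOfThree.
Variable n : nat.
Let q := (3 ^ n.+1)%N.
Local Notation R := ('Z_q).
Local Open Scope ring_scope.
Import GRing.Theory.

Let q_gt1 : (1 < q)%N.
Proof. by rewrite (@ltn_exp2l 3 0). Qed.

Let natr_Zexp3_eq0 (m : nat) : (m%:R == 0 :> R) = (q %| m)%N.
Proof. by rewrite -val_eqE /= val_Zp_nat. Qed.

Lemma three_nil_Zexp3 : (3 : R) ^+ n.+1 = 0.
Proof. by apply/eqP; rewrite -natrX natr_Zexp3_eq0. Qed.

Lemma three_exp_neq0_Zexp3 : (3 : R) ^+ n != 0.
Proof. by rewrite -natrX natr_Zexp3_eq0 dvdn_Pexp2l // ltnn. Qed.

Lemma residue_Zexp3 (r : R) : exists i : nat, r - i%:R \in pow_ideal 3 1.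
Proof. by exists r; rewrite natr_Zp subrr rpred0. Qed.

Lemma card_pow_ideal_Zexp3 : #|pow_ideal (3 : R) 1| = (3 ^ n)%N.
Proof.
have order1 : #[1%R : R]%g = q by rewrite [LHS]order_Zp1 Zp_cast.
have -> : #|pow_ideal (3 : R) 1| = #[(1%R : R) ^+ 3]%g.
  apply: eq_card => r; apply/pow_idealP/cycleP => [[s ->]|[i ->]].
    by exists s; rewrite !FinRing.zmodXgE -[RHS]mulr_natr natr_Zp.
  by exists i%:R; rewrite !FinRing.zmodXgE -[LHS]mulr_natr.
by rewrite orderXdiv order1 /q expnS ?mulKn ?dvdn_mulr.
Qed.

Lemma card_iwahori_Zexp3 : #|[set: iwahori (3 : R)]| = (3 ^ (3 * n + 2))%N.
Proof.
rewrite (card_iwahori three_nil_Zexp3) card_pow_ideal_Zexp3 card_ord Zp_cast //.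
by rewrite /q -!expnD; congr (3 ^ _)%N; lia.
Qed.

End IntegersModPowerOfThree.

Local Open Scope group_scope.

(** * The lower central series *)

Section LowerCentralSeries.
Variables (gT : finGroupType) (G : {group gT}).
Implicit Types (a b g s : gT) (i j k : nat).
Local Notation L k := 'L_k(G).

Lemma lcn_commG i j : [~: L i.+1, L j.+1] \subset L (i + j).+2.
Proof.
elim: j i => [|j IHj] i; first by rewrite addn0 lcn1 lcnSn.
pose N := ('L_(i + j.+1).+2(G))%G; rewrite -[L (i + _).+2]/(gval N).
have nN (A : {set gT}) : A \subset G -> A \subset 'N(N).
  by move=> sAG; apply: subset_trans sAG (lcn_norm _ G).
have sub_comm3 (A B C : {set gT}) : A \subset G -> B \subset G -> C \subset G ->
    ([~: A, B, C] \subset N) = ([~: A / N, B / N, C / N] :==: 1).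
  move=> sAG sBG sCG; have sABG := comm_subG sAG sBG.
  by rewrite -!quotientR ?nN // -subG1 quotient_sub1 // nN // comm_subG.
rewrite commGC (lcnSn j) sub_comm3 ?lcn_sub //.
apply/eqP/three_subgroup; apply/eqP; rewrite -sub_comm3 ?lcn_sub //.
  by rewrite (commGC G) -lcnSn (subset_trans (IHj _)) //= addSnnS.
by rewrite /= addnS (lcnSn (i + j).+1) commSg.
Qed.

Lemma mem_lcn_leq i j a : a \in L i -> j <= i -> a \in L j.
Proof. by move=> La le_ji; apply: subsetP La; apply: lcn_sub_leq. Qed.

Lemma mem_lcnR i j k a b :
  a \in L i -> b \in L j -> k <= i + j -> [~ a, b] \in L k.
Proof.
move=> La Lb le_k; apply: mem_lcn_leq le_k.
have nL c m l : c \in L m -> c \in 'N(L l).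
  by move=> /(subsetP (lcn_sub _ _))/(subsetP (lcn_norm l _)).
case: i j La Lb => [|i] [|j] La Lb.
- by rewrite groupR.
- by rewrite commgEr groupM // memJ_norm ?groupV //; apply: nL La.
- by rewrite addn0 commgEl groupM ?groupV // memJ_norm //; apply: nL Lb.
by rewrite addSn addnS; apply: subsetP (lcn_commG i j) _ _; apply: mem_commg.
Qed.

(* Modulo [H :&: L k.+1] the group [L k] is central, because [T] and [X] commute
and [L k.+1] is central modulo [L k.+2]. *)
Lemma lcn_gen_step (X T : {set gT}) (H : {group gT}) k :
    0 < k -> <<X>> = G -> T \subset L k -> L k \subset T <*> L k.+1 ->
    L k.+2 \subset H -> {in T & X, forall t s, [~ t, s] \in H} ->
  L k.+1 \subset H.
Proof.
move=> k_gt0 genX sTL genL sLH HTX; pose K := (H :&: L k.+1)%G.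
have sGK : [~: L k.+1, G] \subset K.
  by rewrite -lcnSn subsetI sLH lcn_subS.
have nKG : G \subset 'N(K).
  by rewrite -commg_subl (subset_trans _ sGK) // commSg ?subsetIr.
have nK (A : {set gT}) : A \subset G -> A \subset 'N(K).
  by move=> sAG; apply: subset_trans nKG.
have sLG : L k \subset G := lcn_sub k G.
have nKT : T \subset 'N(K) by rewrite nK // (subset_trans sTL).
have nKL : L k.+1 \subset 'N(K) by rewrite nK // lcn_sub.
have cTG : T / K \subset 'C(G / K).
  rewrite centsC -genX quotient_gen ?nK -?genX ?subset_gen // gen_subG.
  rewrite quotient_cents2r // gen_subG.
  apply/subsetP=> _ /imset2P[s t Xs Tt ->].
  have Gs : s \in L 1 by rewrite lcn1 -genX mem_gen.
  rewrite -invg_comm groupV inE HTX //=.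
  by apply: mem_lcnR (subsetP sTL t Tt) Gs _; rewrite addn1.
have: L k / K \subset 'C(G / K).
  apply: subset_trans (quotientS K genL) _.
  by rewrite quotientY // join_subG cTG quotient_cents2r.
rewrite quotient_cents2 ?nK // => /subset_trans/(_ (subsetIl _ _)).
by case: (k) k_gt0.
Qed.

Lemma lcn_comm_cyclic a k : 0 < k -> a \in L k ->
    L k \subset [set a] <*> L k.+1 ->
  [~: L k, L k] \subset L k.*2.+1.
Proof.
case: k => // k _ La genL; pose N := ('L_(k.+1.*2.+1)(G))%G.
have nN (A : {set gT}) : A \subset L k.+1 -> A \subset 'N(N).
  move=> sAL; apply: subset_trans sAL _.
  exact: subset_trans (lcn_sub _ _) (lcn_norm _ _).
have sa : [set a] \subset L k.+1 by rewrite sub1set.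
have sLS : L k.+2 \subset L k.+1 := lcn_subS _ _.
have quoL : L k.+1 / N \subset ([set a] / N) <*> (L k.+2 / N).
  by rewrite -quotientY ?nN ?quotientS.
have centLS (A : {set gT}) : A \subset L k.+1 -> L k.+2 / N \subset 'C(A / N).
  move=> sAL; apply: quotient_cents2r; apply: subset_trans (commgS _ sAL) _.
  by apply: subset_trans (lcn_commG _ _) _; rewrite addSn addnn.
have centLa : L k.+1 / N \subset 'C([set a] / N).
  apply: subset_trans quoL _; rewrite join_subG centLS // andbT.
  by apply: quotient_cents; rewrite cent_set1 sub1set; apply/cent1P.
rewrite -quotient_cents2 ?nN //; apply: subset_trans quoL _.
by rewrite join_subG centsC centLa centLS.
Qed.

Lemma lcn_card_leq p (A : {set gT}) r k : prime p -> #|A| <= r ->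
    {in L k, forall g, g ^+ p \in L k.+1} -> A \subset L k ->
    L k \subset A <*> L k.+1 ->
  #|L k| <= p ^ r * #|L k.+1|.
Proof.
move=> p_pr le_Ar powL sAL genL.
have sLk : L k.+1 \subset L k := lcn_subS k G.
have nL : L k \subset 'N(L k.+1) := normal_norm (lcn_normalS k G).
have genQ : L k / L k.+1 = <<A / L k.+1>>.
  apply/eqP; rewrite eqEsubset gen_subG quotientS // andbT.
  apply: subset_trans (quotientS _ genL) _.
  rewrite quotientY ?normG ?(subset_trans sAL) // trivg_quotient.
  by rewrite join_subG subset_gen sub1G.
have abelQ : p.-abelem (L k / L k.+1).
  apply/abelemP => //; split.
    apply: quotient_cents2r; apply: subset_trans (lcnSnS k G).
    by rewrite commgS // lcn_sub.
  move=> _ /morphimP[g Ng Lg ->]; rewrite -morphX //.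
  by apply/coset_id/powL.
rewrite -(LagrangeI (L k)%G (L k.+1)%G) /= (setIidPr sLk) mulnC leq_mul2r.
rewrite -card_quotient // orbC (card_pgroup (abelem_pgroup abelQ)).
rewrite leq_exp2l ?prime_gt1 // -rank_abelem //.
rewrite -grank_abelian ?(abelem_abelian abelQ) //= genQ.
by rewrite (leq_trans (grank_min _)) // (leq_trans (leq_quotient _ _)).
Qed.

End LowerCentralSeries.

Definition lcn_class (gT : finGroupType) m (a : gT) := coset 'L_m([set: gT]) a.

Notation "a = b %[ 'lcn' m ]" := (lcn_class m a = lcn_class m b)
  (at level 70, b at next level,
   format "'[hv ' a '/'  =  b '/'  %[ 'lcn'  m ] ']'").

Section LcnCongruence.
Variable gT : finGroupType.
Implicit Types (a b c g s : gT) (i j k m : nat).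
Local Notation L k := ('L_k([set: gT])).
Local Notation cls := (@lcn_class gT).

Let normL m a : a \in 'N(L m).
Proof. by rewrite (subsetP (lcn_norm m _)) ?inE. Qed.

Lemma lcn_class1 m : cls m 1 = 1.
Proof. exact: morph1. Qed.
Lemma lcn_classM m a b : cls m (a * b) = cls m a * cls m b.
Proof. by rewrite /lcn_class morphM ?normL. Qed.
Lemma lcn_classV m a : cls m a^-1 = (cls m a)^-1.
Proof. by rewrite /lcn_class morphV ?normL. Qed.
Lemma lcn_classX m a i : cls m (a ^+ i) = cls m a ^+ i.
Proof. by rewrite /lcn_class morphX ?normL. Qed.
Lemma lcn_classR m a b : cls m [~ a, b] = [~ cls m a, cls m b].
Proof. by rewrite /lcn_class morphR ?normL. Qed.

Lemma lcn_class_eq1P m a : reflect (cls m a = 1) (a \in L m).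
Proof.
apply: (iffP idP) => [La | cls_a]; first by rewrite /lcn_class coset_id.
by apply: coset_idr; rewrite ?normL.
Qed.

Lemma eq_lcnP m a b : a = b %[lcn m] <-> a^-1 * b \in L m.
Proof.
split=> [eq_ab|/lcn_class_eq1P].
  by apply/lcn_class_eq1P; rewrite lcn_classM lcn_classV eq_ab mulVg.
by rewrite lcn_classM lcn_classV => /eqP; rewrite -eq_mulVg1 => /eqP.
Qed.

Lemma eq_lcn_leq m k a b : a = b %[lcn m] -> k <= m -> a = b %[lcn k].
Proof.
by move=> /eq_lcnP Lab le_km; apply/eq_lcnP; apply: mem_lcn_leq Lab _.
Qed.

Lemma eq_lcn_mem m a b : a = b %[lcn m] -> (a \in L m) = (b \in L m).
Proof. by move=> eq_ab; apply/lcn_class_eq1P/lcn_class_eq1P; rewrite eq_ab. Qed.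

Lemma eq_lcn_mulr m a b : b \in L m -> a * b = a %[lcn m].
Proof. by move=> /lcn_class_eq1P b1; rewrite lcn_classM b1 mulg1. Qed.

Lemma commute_lcn_class m i j a b :
  a \in L i -> b \in L j -> m <= i + j -> commute (cls m a) (cls m b).
Proof.
move=> La Lb le_m; apply/commgP/eqP; rewrite -lcn_classR.
exact/lcn_class_eq1P/(mem_lcnR La Lb).
Qed.

Lemma mem_lcn1 a : a \in L 1.
Proof. by rewrite inE. Qed.

Lemma mem_lcnRS k a s : a \in L k -> [~ a, s] \in L k.+1.
Proof. by move=> La; apply: mem_lcnR La (mem_lcn1 s) _; rewrite addn1. Qed.

Lemma eq_lcn_commg m a b s : a = b %[lcn m] -> [~ a, s] = [~ b, s] %[lcn m.+1].
Proof.
move=> /eq_lcnP; set d := _ * b => Ld; have -> : b = a * d by rewrite mulKVg.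
have Lasd : [~ [~ a, s], d] \in L m.+1 by apply: mem_lcnR (mem_lcn1 _) Ld _.
rewrite commMgJ conjg_mulR -mulgA [RHS]eq_lcn_mulr //.
by apply: groupM Lasd _; apply: mem_lcnRS.
Qed.

Lemma eq_lcn_cubeM m i j a b :
    a \in L i -> b \in L j -> m <= 2 * i + j -> m <= i + 2 * j ->
  (a * b) ^+ 3 = a ^+ 3 * b ^+ 3 * [~ b, a] ^+ 3 %[lcn m].
Proof.
move=> La Lb le1 le2.
have Lba : [~ b, a] \in L (i + j) by apply: mem_lcnR Lb La _; rewrite addnC.
have commute_a : commute (cls m a) [~ cls m b, cls m a].
  by rewrite -lcn_classR; apply: commute_lcn_class La Lba _; lia.
have commute_b : commute (cls m b) [~ cls m b, cls m a].
  by rewrite -lcn_classR; apply: commute_lcn_class Lb Lba _; lia.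
rewrite lcn_classX lcn_classM (expMg_Rmul 3 commute_b commute_a).
by rewrite -lcn_classR -!lcn_classX -!lcn_classM.
Qed.

Lemma eq_lcn_commgX3 k m a s : a \in L k -> m <= k.*2 + 3 ->
  [~ a, s ^+ 3] = [~ a, s] ^+ 3 * [~ a, s, s] ^+ 3 * [~ a, s, s, s] %[lcn m].
Proof.
have cube_word (c d e : gT) : commute (cls m c) (cls m d) ->
    c * (c * d) * (c * d * d * e) = c ^+ 3 * d ^+ 3 * e %[lcn m].
  move=> comm_cd; rewrite !(lcn_classM, lcn_classX) !expgS !expg0 !mulg1 !mulgA.
  by congr (_ * _ * _ * _); rewrite -!mulgA -comm_cd.
move=> La le_m; set c := [~ a, s].
have -> : [~ a, s ^+ 3] =
    c * (c * [~ c, s]) * (c * [~ c, s] * [~ c, s] * [~ c, s, s]).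
  by rewrite /c /commg /conjg !(expgS, expg0) !gnorm.
apply: cube_word; have Lc := mem_lcnRS s La.
by apply: commute_lcn_class Lc (mem_lcnRS s Lc) _; lia.
Qed.

Lemma lcn_cube_gen k m (A : {set gT}) : m <= k.*2 -> A \subset L k ->
  {in A, forall a, a ^+ 3 \in L m} -> {in <<A>>, forall g, g ^+ 3 \in L m}.
Proof.
move=> le_mk sAL cubeA g; have sL : <<A>> \subset L k by rewrite gen_subG.
have grK : group_set [set g in <<A>> | g ^+ 3 \in L m].
  apply/group_setP; split=> [|a b]; rewrite !inE.
    by rewrite expg1n !group1.
  move=> /andP[Aa a3] /andP[Ab b3]; rewrite groupM //=.
  have [La Lb] := (subsetP sL a Aa, subsetP sL b Ab).
  rewrite (eq_lcn_mem (eq_lcn_cubeM La Lb _ _)); try lia.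
  apply: groupM; first exact: groupM.
  by apply/groupX/(mem_lcnR Lb La); rewrite addnn.
suff /subsetP sAK : <<A>> \subset Group grK.
  by move=> /sAK; rewrite inE => /andP[].
rewrite gen_subG; apply/subsetP=> a Aa.
by rewrite inE mem_gen //= cubeA.
Qed.

Lemma lcn_cube_commg m k : 0 < k -> m <= k.+1.*2 ->
    (forall g s, g \in L k -> [~ g, s] ^+ 3 \in L m) ->
  forall g, g \in L k.+1 -> g ^+ 3 \in L m.
Proof.
case: k => // k _ le_mk cubeR; apply: lcn_cube_gen le_mk _ _.
  by rewrite -gen_subG.
by move=> _ /imset2P[g s Lg _ ->]; apply: cubeR.
Qed.

End LcnCongruence.

Section CubesInLcn.
Variable gT : finGroupType.
Implicit Types (a b g s : gT) (k m : nat).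
Local Notation L k := ('L_k([set: gT])).

Hypothesis cube_lcn2 : forall g, g ^+ 3 \in L 2.

Lemma lcn_cubeS k g : 0 < k -> g \in L k -> g ^+ 3 \in L k.+1.
Proof.
case: k => // k _; elim: k g => [|k IHk] g; first by move=> _; apply: cube_lcn2.
apply: lcn_cube_commg => // [|{}g s Lg]; first by lia.
have Lgs := mem_lcnRS s Lg.
apply/lcn_class_eq1P; rewrite lcn_classX lcn_classR -commXg.
  by rewrite -lcn_classX -lcn_classR; apply/lcn_class_eq1P/mem_lcnRS/IHk.
by rewrite -lcn_classR; apply: commute_lcn_class Lg Lgs _; lia.
Qed.

Lemma eq_lcn_commXg3 k m g s : 1 < k -> m <= k + 4 -> g \in L k ->
  [~ g ^+ 3, s] = [~ g, s] ^+ 3 %[lcn m].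
Proof.
move=> k_gt1 le_m Lg; have Lgs := mem_lcnRS s Lg.
rewrite [[~ _ ^+ 3, _]]commgEl conjXg conjg_mulR.
rewrite lcn_classM (@eq_lcn_cubeM _ _ k k.+1) //; try lia.
rewrite -lcn_classM -mulgA mulKg eq_lcn_mulr //.
have Lgsg : [~ g, s, g] \in L (k.+1 + k) by apply: mem_lcnR Lgs Lg _.
by apply: mem_lcn_leq (lcn_cubeS _ Lgsg) _; lia.
Qed.

Hypothesis cube_lcn4 : forall g, g \in L 2 -> g ^+ 3 \in L 4.

Lemma lcn_cubeSS k g : 1 < k -> g \in L k -> g ^+ 3 \in L k.+2.
Proof.
case: k => [|[|k]] // _; elim: k g => [|k IHk] g; first exact: cube_lcn4.
apply: lcn_cube_commg => // [|{}g s Lg]; first by lia.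
rewrite -(eq_lcn_mem (eq_lcn_commXg3 s _ _ Lg)) //; last by lia.
exact/mem_lcnRS/IHk.
Qed.

Lemma eq_lcn_cube k a b : 1 < k -> a \in L k ->
  a = b %[lcn k.+1] -> a ^+ 3 = b ^+ 3 %[lcn k.+3].
Proof.
move=> k_gt1 La /eq_lcnP; set d := _ * b => Ld.
have -> : b = a * d by rewrite mulKVg.
rewrite (@eq_lcn_cubeM _ _ k k.+1) //; try lia.
rewrite [RHS]eq_lcn_mulr.
  by rewrite [RHS]eq_lcn_mulr // lcn_cubeSS // ltnW.
by apply: groupX; apply: mem_lcnR Ld La _; lia.
Qed.

Lemma eq_lcn_commg_cube k g s b : 1 < k -> g \in L k ->
  [~ g, s] = b %[lcn k.+2] -> [~ g ^+ 3, s] = b ^+ 3 %[lcn k.+4].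
Proof.
move=> k_gt1 Lg eq_gs; rewrite (eq_lcn_commXg3 s k_gt1 _ Lg); last by lia.
by apply: eq_lcn_cube eq_gs; rewrite ?mem_lcnRS // ltnW.
Qed.

End CubesInLcn.

Lemma odd_sqr_mem (gT : finGroupType) (G H : {group gT}) (a : gT) :
  odd #|G| -> a \in G -> a ^+ 2 \in H -> a \in H.
Proof.
rewrite -coprimen2 => co2 Ga Ha2; rewrite -[a](expgK co2 Ga).
exact: groupX.
Qed.

Lemma odd_sqr_inj (gT : finGroupType) (G : {group gT}) :
  odd #|G| -> {in G &, injective (fun a => a ^+ 2)}.
Proof. by rewrite -coprimen2 => /expgK/can_in_inj. Qed.

(* In a 3-group squaring is injective, so [r_n^-1 sigma(r_n) = 1] amounts to
[x ^+ 3 = y ^+ (3 ^ n)]. *)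
Definition Gn_relations (G : groupType) n (x y : G) : Prop :=
  x ^+ 3 = y ^+ (3 ^ n) /\
  y * x * y * x^-1 * y = y^-1 * x^-1 * y^-1 * x * y^-1.

Section UpperBound.
Variables (gT : finGroupType) (x y : gT) (n : nat).
Local Notation L k := ('L_k([set: gT])).
Local Notation cls := (@lcn_class gT).
Hypotheses (pG : 3.-group [set: gT]) (genG : <<[set x; y]>> = [set: gT]).
Hypotheses (n_gt0 : 0 < n) (rel_xy : Gn_relations n x y).
Implicit Types (a b g s : gT) (j k m : nat).

Let w := [~ y, x].

Let odd_mem (H : {group gT}) a : a ^+ 2 \in H -> a \in H.
Proof. by apply: odd_sqr_mem (odd_pgroup_odd _ pG) _; rewrite ?inE. Qed.

Let w_lcn2 : w \in L 2. Proof. exact/mem_lcnRS/mem_lcn1. Qed.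

Lemma second_relation_comm (w' := w ^ x^-1) :
  y ^+ 3 ^+ 2 * [~ y ^+ 3, w'] * [~ w', x] = 1.
Proof.
pose E := y * x * y * x^-1 * y * (y * x^-1 * y * x * y).
have -> : y ^+ 3 ^+ 2 * [~ y ^+ 3, w'] * [~ w', x] = y * E * y^-1.
  by rewrite /E /w' /w /commg /conjg !(expgS, expg0) !gnorm.
suff -> : E = 1 by rewrite mulg1 mulgV.
by rewrite /E rel_xy.2 !gnorm.
Qed.

Lemma cube_y_lcn2 : y ^+ 3 \in L 2.
Proof.
apply: (@odd_mem 'L_2([set: gT])%G) => /=.
have := group1 'L_2([set: gT])%G; rewrite -second_relation_comm.
by do 2![rewrite (groupMr _ (mem_lcnRS _ (mem_lcn1 _)))].
Qed.

Lemma cube_lcn2 g : g ^+ 3 \in L 2.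
Proof.
apply: (@lcn_cube_gen _ 1 2 [set x; y]) => //; rewrite ?genG ?inE //.
  by rewrite lcn1 subsetT.
move=> a /set2P[]->; last exact: cube_y_lcn2.
by rewrite rel_xy.1 -(subnKC n_gt0) expnS expgM groupX ?cube_y_lcn2.
Qed.

Lemma gen_lcn2 : L 2 \subset [set w] <*> L 3.
Proof.
apply: (@lcn_gen_step _ [set: gT] [set x; y] [set x; y]) => //.
- by rewrite lcn1 subsetT.
- by rewrite /= lcn1 -genG genS ?subsetUl.
- exact: joing_subr.
have gen_w : w \in [set w] <*> L 3 by rewrite mem_gen // !inE eqxx.
move=> t s /set2P[]-> /set2P[]->; rewrite ?commgg ?group1 //.
by rewrite -invg_comm groupV.
Qed.

Lemma eq_lcn_cube_w :
  w ^+ 3 * [~ w, x] ^+ 3 * [~ w, x, x] = 1 %[lcn 5].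
Proof.
rewrite -(eq_lcn_commgX3 x (mem_lcn1 y)) // rel_xy.1.
by have /commgP/eqP-> : commute y (y ^+ (3 ^ n)) by apply: commuteX.
Qed.

Lemma cube_w_lcn4 : w ^+ 3 \in L 4.
Proof.
have Lwx := mem_lcnRS x w_lcn2.
have := group1 'L_4([set: gT])%G.
rewrite -(eq_lcn_mem (eq_lcn_leq eq_lcn_cube_w _)) //.
by rewrite (groupMr _ (mem_lcnRS x Lwx)) groupMr // (lcn_cubeS cube_lcn2 _ Lwx).
Qed.

Lemma cube_lcn4 g : g \in L 2 -> g ^+ 3 \in L 4.
Proof.
move=> /(subsetP gen_lcn2); apply: (@lcn_cube_gen _ 2) => //.
  by rewrite subUset sub1set w_lcn2 lcn_subS.
move=> a /setUP[/set1P->|La]; first exact: cube_w_lcn4.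
by apply: (lcn_cubeS cube_lcn2 _ La).
Qed.

Lemma eq_lcn_comm_yxxx : [~ w, x, x] = (w ^+ 3)^-1 %[lcn 5].
Proof.
have cube_wx : [~ w, x] ^+ 3 \in L 5.
  by apply: (lcn_cubeSS cube_lcn2 cube_lcn4 _ (mem_lcnRS x w_lcn2)).
have := eq_lcn_cube_w.
rewrite lcn_classM (eq_lcn_mulr (w ^+ 3) cube_wx) lcn_class1 lcn_classV.
by move=> /eqP; rewrite -eq_invg_mul => /eqP->.
Qed.

Let w' := w ^ x^-1.

Let eq_lcn_w' : w' = w %[lcn 3].
Proof. by rewrite /w' conjg_mulR eq_lcn_mulr ?mem_lcnRS. Qed.

Let w'_lcn2 : w' \in L 2.
Proof. by rewrite (eq_lcn_mem (eq_lcn_leq eq_lcn_w' _)). Qed.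

Let comm_cube_y_w' : [~ y ^+ 3, w'] \in L 4.
Proof. exact: mem_lcnR cube_y_lcn2 w'_lcn2 _. Qed.

Lemma cube_y_lcn3 : y ^+ 3 \in L 3.
Proof.
apply: (@odd_mem 'L_3([set: gT])%G) => /=.
have := group1 'L_3([set: gT])%G; rewrite -second_relation_comm.
rewrite (groupMr _ (mem_lcnRS x w'_lcn2)).
by rewrite (groupMr _ (mem_lcn_leq comm_cube_y_w' _)).
Qed.

Lemma eq_lcn_cube_y : y ^+ 3 = [~ w, x] %[lcn 4].
Proof.
have /lcn_class_eq1P : y ^+ 3 ^+ 3 \in L 4.
  by apply: (lcn_cubeS cube_lcn2 _ cube_y_lcn3).
rewrite lcn_classX => y9; apply: (mulgI (cls 4 (y ^+ 3) ^+ 2)).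
rewrite -expgSr y9 -(eq_lcn_commg x eq_lcn_w') -lcn_classX.
rewrite -(eq_lcn_mulr (y ^+ 3 ^+ 2) comm_cube_y_w') -lcn_classM.
by rewrite second_relation_comm lcn_class1.
Qed.

Lemma eq_lcn_comm_cube_y_x : [~ y ^+ 3, x] = (w ^+ 3)^-1 %[lcn 5].
Proof. by rewrite (eq_lcn_commg x eq_lcn_cube_y) eq_lcn_comm_yxxx. Qed.

Lemma comm_yxxy_lcn5 : [~ w, x, y] \in L 5.
Proof.
rewrite -(eq_lcn_mem (eq_lcn_commg y eq_lcn_cube_y)).
by have /commgP/eqP-> : commute (y ^+ 3) y by apply/commute_sym/commuteX.
Qed.

(* [x y] and [y x] differ by [w], which commutes with itself. *)
Lemma comm_yxyx_lcn5 : [~ w, y, x] \in L 5.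
Proof.
have eq_xy_yx : [~ w, x * y] = [~ w, y * x] %[lcn 5].
  rewrite (commgC x y) -(invg_comm y x) -/w (commgMR w (y * x) w^-1).
  have /commgP/eqP-> : commute w w^-1 by apply: commuteV.
  rewrite mul1g eq_lcn_mulr //.
  by apply: (@mem_lcnR _ _ 3 2); rewrite ?mem_lcnRS ?groupV.
move: eq_xy_yx; rewrite (commgMR w x y) (commgMR w y x).
rewrite (eq_lcn_mulr _ comm_yxxy_lcn5) (lcn_classM _ ([~ w, x] * _)).
have -> : [~ w, y] * [~ w, x] = [~ w, x] * [~ w, y] %[lcn 5].
  rewrite !(lcn_classM _ [~ w, _]).
  exact: commute_lcn_class (mem_lcnRS y w_lcn2) (mem_lcnRS x w_lcn2) _.
by rewrite -[LHS]mulg1 => /mulgI/esym/lcn_class_eq1P.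
Qed.

Lemma eq_lcn_comm_yxyy : [~ w, y, y] = (w ^+ 3) ^- 2 %[lcn 5].
Proof.
have Lwy s : [~ w, s] \in L 3 by apply: mem_lcnRS.
have LVwy : [~ w^-1, y] \in L 3 by rewrite mem_lcnRS ?groupV.
have commV a : a \in L 2 -> [~ a^-1, y] = [~ a, y]^-1 %[lcn 5].
  move=> La; rewrite lcn_classR !lcn_classV lcn_classR commVg // -lcn_classR.
  by apply: commute_lcn_class La (mem_lcnRS y La) _.
have eq_VV : [~ w^-1, y, y] = [~ w, y, y]^-1 %[lcn 5].
  rewrite -(commV _ (mem_lcn_leq (Lwy y) _)) //; apply: eq_lcn_commg.
  exact: eq_lcn_leq (commV _ w_lcn2) _.
have := eq_lcn_commgX3 y (mem_lcn1 x) (leqnn 5).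
rewrite -(invg_comm y x) -(invg_comm (y ^+ 3) x) -/w.
rewrite (lcn_classV 5 [~ y ^+ 3, x]) eq_lcn_comm_cube_y_x -lcn_classV invgK.
have cube_wy : [~ w^-1, y] ^+ 3 \in L 5.
  exact: (lcn_cubeSS cube_lcn2 cube_lcn4 _ LVwy).
rewrite (lcn_classM _ (_ ^+ 3 * _)) (eq_lcn_mulr _ cube_wy) eq_VV.
rewrite expgVn !lcn_classV => eq_w3; apply: invg_inj.
by rewrite invgK lcn_classX expgS expg1 {2}eq_w3 mulKVg.
Qed.

Let wpow j := w ^+ (3 ^ j).

Let wpowS j : wpow j.+1 = wpow j ^+ 3.
Proof. by rewrite /wpow expnSr expgM. Qed.

Let cube_lcnSS k g : 1 < k -> g \in L k -> g ^+ 3 \in L k.+2.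
Proof. exact: lcn_cubeSS cube_lcn2 cube_lcn4 k g. Qed.

Let mem_wpow j : wpow j \in L j.+1.*2.
Proof.
elim: j => [|j IHj]; first exact: w_lcn2.
by rewrite wpowS; apply: cube_lcnSS IHj.
Qed.

Let mem_wpowR j s : [~ wpow j, s] \in L j.+1.*2.+1.
Proof. exact/mem_lcnRS/mem_wpow. Qed.

Lemma eq_lcn_comm_wpow j s s' : s \in [set x; y] -> s' \in [set x; y] ->
  exists e, [~ wpow j, s, s'] = wpow j.+1 ^+ e %[lcn j.+2.*2.+1].
Proof.
move=> Xs Xs'; elim: j => [|j [e IHj]].
  have inv_exp a : exists e, a^-1 = a ^+ e.
    by exists (#[a]).-1; rewrite invg_expg.
  have wpow1 : wpow 1 = w ^+ 3 by [].
  rewrite wpow1 /wpow expg1; case/set2P: Xs => ->; case/set2P: Xs' => ->.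
  - by have [e De] := inv_exp (w ^+ 3); exists e; rewrite -De eq_lcn_comm_yxxx.
  - by exists 0; apply/esym/eq_lcnP; rewrite invg1 mul1g comm_yxxy_lcn5.
  - by exists 0; apply/esym/eq_lcnP; rewrite invg1 mul1g comm_yxyx_lcn5.
  - have [e De] := inv_exp (w ^+ 3 ^+ 2); exists (2 * e)%N.
    by rewrite expgM -De eq_lcn_comm_yxyy.
exists e; have cubeR : [~ wpow j.+1, s] = [~ wpow j, s] ^+ 3 %[lcn j.+1.*2 + 4].
  by rewrite wpowS; apply: (eq_lcn_commXg3 cube_lcn2 s _ _ (mem_wpow j)).
rewrite addn4 in cubeR; rewrite (eq_lcn_commg s' cubeR).
rewrite [wpow j.+2]wpowS -expgM mulnC expgM.
exact: (eq_lcn_commg_cube cube_lcn2 cube_lcn4 _ (mem_wpowR j s) IHj).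
Qed.

Let gen_lcn_odd_of_even j :
    L j.+1.*2 \subset [set wpow j] <*> L j.+1.*2.+1 ->
  L j.+1.*2.+1 \subset [set [~ wpow j, x]; [~ wpow j, y]] <*> L j.+2.*2.
Proof.
move=> gen_even.
apply: (@lcn_gen_step _ [set: gT] [set x; y] [set wpow j]) => //.
- by rewrite sub1set.
- exact: joing_subr.
by move=> t s /set1P-> /set2P[]->; rewrite mem_gen // !inE eqxx ?orbT.
Qed.

Lemma gen_lcn_even j : L j.+1.*2 \subset [set wpow j] <*> L j.+1.*2.+1.
Proof.
elim: j => [|j IHj]; first exact: gen_lcn2.
have gen_odd := gen_lcn_odd_of_even IHj.
pose T := [set [~ wpow j, x]; [~ wpow j, y]].
apply: (@lcn_gen_step _ [set: gT] [set x; y] T) => //.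
- by rewrite subUset !sub1set !mem_wpowR.
- exact: joing_subr.
move=> t s' Xt Xs'.
have [s Xs ->] : exists2 s, s \in [set x; y] & t = [~ wpow j, s].
  by case/set2P: Xt => ->; [exists x | exists y]; rewrite // !inE eqxx ?orbT.
have [e /esym/eq_lcnP Le] := eq_lcn_comm_wpow j Xs Xs'.
rewrite -[[~ _, s, s']](mulKVg (wpow j.+1 ^+ e)) groupM //.
  by rewrite groupX // mem_gen // !inE eqxx.
by rewrite mem_gen // inE Le orbT.
Qed.

Lemma gen_lcn_odd j :
  L j.+1.*2.+1 \subset [set [~ wpow j, x]; [~ wpow j, y]] <*> L j.+2.*2.
Proof. exact/gen_lcn_odd_of_even/gen_lcn_even. Qed.

Lemma y_pow_lcn j : y ^+ (3 ^ j.+1) \in L j.+1.*2.+1.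
Proof.
elim: j => [|j IHj]; first exact: cube_y_lcn3.
by rewrite expnSr expgM; apply: cube_lcnSS IHj.
Qed.

Lemma eq_lcn_comm_y_pow j :
  [~ y ^+ (3 ^ j.+1), x] = (wpow j.+1)^-1 %[lcn j.+2.*2.+1].
Proof.
elim: j => [|j IHj]; first exact: eq_lcn_comm_cube_y_x.
rewrite expnSr expgM wpowS -expgVn.
exact: (eq_lcn_commg_cube cube_lcn2 cube_lcn4 _ (y_pow_lcn j) IHj).
Qed.

(* The element [y ^+ (3 ^ n)] is central, which makes [wpow n] fall one step
deeper than expected, and with it the whole of [L n.+1.*2]. *)
Lemma lcn_Gn_trivial : L n.+1.*2 = 1.
Proof.
have /forall_inP/(_ 'L_(n.+1.*2)([set: gT])%G) := pgroup_nil pG.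
rewrite subsetI subsetT -lcnSn => triv; apply/eqP/triv => /=.
have [j Dn] : exists j, n = j.+1 by case: (n) n_gt0 => // j _; exists j.
have := eq_lcn_comm_y_pow j; rewrite -Dn -rel_xy.1.
have /commgP/eqP-> : commute (x ^+ 3) x by apply/commute_sym/commuteX.
rewrite lcn_class1 lcn_classV => /(canLR (@invgK _)).
rewrite invg1 => /esym/lcn_class_eq1P Lwpow.
apply: subset_trans (gen_lcn_even n) _.
by rewrite join_subG sub1set subxx Lwpow.
Qed.

Let card_lcn k (A : {set gT}) r : 0 < k -> #|A| <= r -> A \subset L k ->
  L k \subset A <*> L k.+1 -> #|L k| <= 3 ^ r * #|L k.+1|.
Proof.
move=> k_gt0 le_Ar sAL genL; apply: lcn_card_leq le_Ar _ sAL genL => // g.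
exact: (lcn_cubeS cube_lcn2 k_gt0).
Qed.

Lemma card_lcn_odd_step j : #|L j.*2.+1| <= 3 ^ 2 * #|L j.+1.*2|.
Proof.
have card2 a b : #|[set a; b]| <= 2 by rewrite cards2 ltnS leq_b1.
case: j => [|j].
  apply: (card_lcn _ (card2 x y)); rewrite // lcn1 ?subsetT //.
  by rewrite -genG genS ?subsetUl.
apply: (card_lcn _ (card2 [~ wpow j, x] [~ wpow j, y])) => //.
  by rewrite subUset !sub1set !mem_wpowR.
exact: gen_lcn_odd.
Qed.

Lemma card_lcn_even_step j : #|L j.+1.*2| <= 3 * #|L j.+1.*2.+1|.
Proof.
by apply: (@card_lcn _ [set wpow j] 1); rewrite ?cards1 ?sub1set ?gen_lcn_even.
Qed.

Lemma card_Gn_leq_lcn_odd j : #|[set: gT]| <= 3 ^ (3 * j) * #|L j.*2.+1|.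
Proof.
elim: j => [|j IHj]; first by rewrite mul1n.
apply: leq_trans IHj _.
rewrite mulnS addnC expnD -mulnA leq_pmul2l ?expn_gt0 //.
apply: leq_trans (card_lcn_odd_step j) _.
by rewrite (expnD 3 2 1) -mulnA leq_pmul2l ?card_lcn_even_step.
Qed.

Lemma card_Gn_leq : #|[set: gT]| <= 3 ^ (3 * n + 2).
Proof.
apply: leq_trans (card_Gn_leq_lcn_odd n) _.
rewrite expnD leq_pmul2l ?expn_gt0 //.
by have := card_lcn_odd_step n; rewrite lcn_Gn_trivial cards1 muln1.
Qed.

Lemma der_sub_lcn d : [set: gT]^`(d) \subset L (der_index d).
Proof.
elim: d => [|d IHd]; first by rewrite lcn1.
rewrite dergSn; apply: subset_trans (commgSS IHd IHd) _.
rewrite -[der_index d.+1]/(next_der_index (der_index d)) /next_der_index.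
move: (der_index d) (der_index_gt0 d) => [//|m] _.
case: ifPn; first by rewrite doubleS -addnn lcn_commG.
rewrite oddS negbK => odd_m.
have -> : m.+1 = m./2.+1.*2 by rewrite -{1}[m]odd_double_half odd_m.
exact: lcn_comm_cyclic (mem_wpow _) (gen_lcn_even _).
Qed.

Hypothesis cardG : #|[set: gT]| = (3 ^ (3 * n + 2))%N.

Lemma nil_class_Gn : nil_class [set: gT] = (2 * n + 1)%N.
Proof.
have nilG := pgroup_nil pG; apply/eqP; rewrite addn1 mul2n eqn_leq.
apply/andP; split; first exact/(lcn_nil_classP _ nilG)/lcn_Gn_trivial.
rewrite ltnNge; apply/negP=> /(lcn_nil_classP _ nilG) triv.
have := card_Gn_leq_lcn_odd n.
rewrite triv cards1 muln1 cardG leq_exp2l //; lia.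
Qed.

Lemma derived_length_Gn :
    (forall d, 0 < d -> der_index d < n.+1.*2 -> [set: gT]^`(d) != 1) ->
  has_derived_length [set: gT] (trunc_log 2 (3 * n + 3)).
Proof.
move=> der_neq1; split=> [|d].
  apply/trivgP; apply: subset_trans (der_sub_lcn _) _; rewrite -lcn_Gn_trivial.
  by rewrite lcn_sub_leq // leqNgt der_index_lt_trunc_log ltnn.
rewrite -der_index_lt_trunc_log => lt_d; apply/eqP.
case: d lt_d => [|d] lt_d; last exact: der_neq1.
rewrite derg0 -cardG_gt1 cardG.
by apply: (@leq_trans (3 ^ 1)); rewrite ?leq_exp2l //; lia.
Qed.

End UpperBound.

Section GroupHom.
Variables (G H : groupType) (f : G -> H).
Hypothesis fM : {morph f : u v / u * v}.

Fact hom_divg : {morph f : u v / u * v^-1}.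
Proof. by move=> u v; apply: (mulIg (f v)); rewrite -fM !mulgKV. Qed.
HB.instance Definition _ := monoid.isGroupMorphism.Build G H f hom_divg.

Lemma hom1 : f 1 = 1. Proof. exact: gmulf1. Qed.
Lemma homV u : f u^-1 = (f u)^-1. Proof. exact: gmulfV. Qed.
Lemma homX k u : f (u ^+ k) = f u ^+ k. Proof. exact: gmulfXn. Qed.

Lemma hom_eqP u v : f u = f v <-> f (u^-1 * v) = 1.
Proof.
rewrite fM homV; split=> [->|/eqP]; first by rewrite mulVg.
by rewrite mulg_eq1 eqg_inv => /eqP.
Qed.

Lemma Gn_relations_inj n x y :
  injective f -> Gn_relations n (f x) (f y) -> Gn_relations n x y.
Proof.
by move=> f_inj [rel_x rel_t]; split; apply: f_inj; rewrite !(homX, homV, fM).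
Qed.

End GroupHom.

Lemma expg_pair (gT rT : finGroupType) (u : gT * rT) k :
  u ^+ k = (u.1 ^+ k, u.2 ^+ k).
Proof. by elim: k => [|k IHk]; rewrite ?expg0 // !expgS IHk. Qed.

Section SubgroupType.
Variables (gT : finGroupType) (G : {group gT}).
Local Notation sG := [set: subg_of G].

Lemma subg_gen (A : {set gT}) : <<A>> = G -> <<subg G @: A>> = sG.
Proof.
move=> genG; have sAG : A \subset G by rewrite -genG subset_gen.
by rewrite -morphimEsub // -morphim_gen // genG im_subg.
Qed.

Lemma pgroup_subg p : p.-group sG = p.-group G.
Proof. by rewrite -(isog_pgroup p (isog_subg G)). Qed.

Lemma card_subg_type : #|sG| = #|G|.
Proof. by rewrite -(card_isog (isog_subg G)). Qed.

Lemma subg_der_neq1 k : G^`(k) != 1 -> sG^`(k) != 1.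
Proof.
apply: contra_neq => triv.
by rewrite -(im_sgval G) -morphim_der ?subsetT // triv morphim1.
Qed.

Lemma subg_set2 x y : subg G @: [set x; y] = [set subg G x; subg G y].
Proof. by rewrite imsetU !imset_set1. Qed.

End SubgroupType.

Lemma card_gen_Gn_leq (gT : finGroupType) (x y : gT) n : 0 < n ->
    3.-group <<[set x; y]>> -> Gn_relations n x y ->
  #|<<[set x; y]>>| <= 3 ^ (3 * n + 2).
Proof.
move=> n_gt0 pG rel_xy; pose G := <<[set x; y]>>%G.
have [Gx Gy] : x \in G /\ y \in G by rewrite !mem_gen // !inE eqxx ?orbT.
rewrite -(card_subg_type G).
apply: (@card_Gn_leq _ (subg G x) (subg G y)) => //.
- by rewrite pgroup_subg.
- by rewrite -subg_set2; apply: subg_gen.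
apply: (@Gn_relations_inj _ _ (@sgval _ G)) => //; first exact: subg_inj.
by rewrite !subgK.
Qed.

Lemma fun_of_small_graph (gT rT : finGroupType) (D : {group gT * rT}) :
    #|D| <= #|[set u.1 | u in D]| ->
  exists f : gT -> rT, {in D, forall u, f u.1 = u.2}.
Proof.
move=> le_D; have /imset_injP fst_inj : #|[set u.1 | u in D]| == #|D|.
  by rewrite eqn_leq leq_imset_card le_D.
exists (fun g => oapp snd 1 [pick u in D | u.1 == g]) => u Du.
case: pickP => [v /andP[Dv /eqP eq_vu]|/(_ u)]; last by rewrite Du eqxx.
by rewrite (fst_inj v u).
Qed.

(* The subgroup of [gT * rT] generated by [(x, a)] and [(y, b)] satisfies the
relations, so it is no larger than [gT] and is the graph of a function. *)
Lemma Gn_von_dyck n (gT rT : finGroupType) (x y : gT) (a b : rT) : 0 < n ->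
    3.-group [set: gT] -> <<[set x; y]>> = [set: gT] ->
    #|[set: gT]| = (3 ^ (3 * n + 2))%N -> Gn_relations n x y ->
    3.-group [set: rT] -> Gn_relations n a b ->
  exists f : gT -> rT, [/\ {morph f : u v / u * v}, f x = a & f y = b].
Proof.
move=> n_gt0 pG genG cardG rel_xy pR rel_ab.
pose D := <<[set (x, a); (y, b)]>>%G.
have [Dx Dy] : (x, a) \in D /\ (y, b) \in D.
  by rewrite !mem_gen // !inE eqxx ?orbT.
have pD : 3.-group D.
  apply: (pgroupS (subsetT _)).
  by rewrite /pgroup cardsT card_prod pnatM -!cardsT; apply/andP.
have rel_D : Gn_relations n (x, a) (y, b).
  case: rel_xy rel_ab => [rel_x rel_t] [rel_a rel_b]; split; last by congr pair.
  by rewrite !expg_pair /= rel_x rel_a.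
have fstD : [set u.1 | u in D] = [set: gT].
  rewrite -(morphimEsub (fst_morphism gT rT)) ?subsetT //.
  by rewrite morphim_gen ?morphimEsub ?subsetT // imsetU !imset_set1.
have [|f fD] := @fun_of_small_graph _ _ D.
  by rewrite fstD cardG card_gen_Gn_leq.
exists f; split; [|exact: (fD (x, a))|exact: (fD (y, b))] => u v.
have: u \in [set u.1 | u in D] by rewrite fstD inE.
have: v \in [set u.1 | u in D] by rewrite fstD inE.
move=> /imsetP[v' Dv' ->] /imsetP[u' Du' ->].
by rewrite (fD u') // (fD v') // -[_ * _]/((u' * v').1) fD ?groupM.
Qed.

(* The generators satisfy [x ^+ 3 = 1] rather than [x ^+ 3 = y ^+ (3 ^ n)]; an
element of order 9 in a central factor, whose cube is identified with
[y ^+ (3 ^ n)], corrects this. *)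
Section CentralTwist.
Variables (S : finGroupType) (x y : S) (n : nat).
Hypothesis pS : 3.-group [set: S].
Hypothesis genS : <<[set x; y]>> = [set: S].
Hypothesis cube_x : x ^+ 3 = 1.
Hypothesis y_pow_central : forall u, commute (y ^+ (3 ^ n)) u.
Hypothesis y_pow_cube : y ^+ (3 ^ n) ^+ 3 = 1.
Hypothesis second_rel : y * x * y * x^-1 * y = y^-1 * x^-1 * y^-1 * x * y^-1.

Let z : 'I_9 := Zp1.
Let T := (S * 'I_9)%type.
Let X : T := (x, z).
Let Y : T := (y, 1).
Let E := <<[set X; Y]>>%G.
Let c : T := ((y ^+ (3 ^ n))^-1, z ^+ 3).
Let C := <[c]>%G.

Let abelian_I9 : abelian [set: 'I_9].
Proof. exact: Zp_abelian. Qed.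

Let order_z3 : #[z ^+ 3] = 3.
Proof. by rewrite orderXdiv /z order_Zp1. Qed.

Let cX : c = X ^+ 3 * (Y ^+ (3 ^ n))^-1.
Proof.
rewrite !expg_pair /= cube_x expg1n.
by congr pair; rewrite /= ?mul1g ?invg1 ?mulg1.
Qed.

Let c_cube : c ^+ 3 = 1.
Proof.
have z9 : z ^+ 3 ^+ 3 = 1 by apply/eqP; rewrite -order_dvdn order_z3.
by rewrite expg_pair /= expgVn y_pow_cube invg1 z9.
Qed.

Let normC (A : {set T}) : A \subset 'N(C).
Proof.
apply: cents_norm; rewrite centsC cycle_subG; apply/centP=> u _.
congr pair => /=.
  exact/commute_sym/commuteV/commute_sym/y_pow_central.
by apply: (centsP abelian_I9); rewrite inE.
Qed.

Let EX : X \in E. Proof. by rewrite mem_gen // !inE eqxx. Qed.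
Let EY : Y \in E. Proof. by rewrite mem_gen // !inE eqxx orbT. Qed.
Let sCE : C \subset E.
Proof. by rewrite cycle_subG cX groupM ?groupV ?groupX. Qed.

Let fstE : fst @* E = [set: S].
Proof.
by rewrite morphim_gen ?morphimEsub ?subsetT // imsetU !imset_set1.
Qed.

Let cardE : 3 * #|[set: S]| <= #|E|.
Proof.
rewrite -fstE card_morphim setTI -[leqRHS](LagrangeI E ('ker (@fst S 'I_9))).
rewrite leq_mul2r; apply/orP; right; have Dz : X ^+ 3 = (1, z ^+ 3).
  by rewrite expg_pair /= cube_x.
have : #[z ^+ 3] %| #[X ^+ 3].
  rewrite order_dvdn Dz.
  by have /eqP := expg_order ((1, z ^+ 3) : T); rewrite expg_pair => /eqP[_ ->].
rewrite order_z3 => /(dvdn_leq (order_gt0 _))/leq_trans; apply.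
rewrite orderE subset_leq_card // cycle_subG inE groupX //=.
by apply/kerP; rewrite ?inE // Dz.
Qed.

Let snd_derE k u : u \in E^`(k.+1) -> u.2 = 1.
Proof.
move=> Eu; have : snd u \in snd @* E^`(k.+1).
  by apply: mem_morphim; rewrite ?inE.
rewrite morphim_der ?subsetT // dergSn.
move=> /(subsetP (commgSS (subsetT _) (subsetT _))).
by rewrite -derg1 (derG1P abelian_I9) => /set1gP.
Qed.

Let derE_sub_C k : E^`(k.+1) \subset C -> E^`(k.+1) = 1.
Proof.
move=> sEC; apply/trivgP/subsetP=> u Eu; have /cycleP[i Du] := subsetP sEC u Eu.
have : #[z ^+ 3] %| i.
  by rewrite order_dvdn; have /eqP := snd_derE Eu; rewrite Du expg_pair.
rewrite order_z3 => /dvdnP[j Di].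
by rewrite Du Di mulnC expgM c_cube expg1n set11.
Qed.

Let Gt := (E / C)%G.

Lemma twist_gen : <<[set coset C X; coset C Y]>> = Gt.
Proof.
by rewrite /= quotient_gen // quotientE morphimEsub // imsetU !imset_set1.
Qed.

Lemma twist_pgroup : 3.-group Gt.
Proof.
apply: quotient_pgroup; apply: (pgroupS (subsetT _)).
by rewrite /pgroup cardsT card_prod card_ord pnatM -cardsT; apply/andP.
Qed.

Lemma twist_card : #|[set: S]| <= #|Gt|.
Proof.
rewrite card_quotient // -(leq_pmul2l (isT : 0 < 3)); apply: leq_trans cardE _.
rewrite -(Lagrange sCE) leq_mul2r; apply/orP; right.
by rewrite -orderE dvdn_leq // order_dvdn c_cube.
Qed.

Lemma twist_relations : Gn_relations n (coset C X) (coset C Y).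
Proof.
have inN u : u \in 'N(C) by rewrite (subsetP (normC [set u])) ?inE.
have cosetM : {morph coset C : u v / u * v} by move=> u v; rewrite morphM.
split.
  rewrite -!(homX cosetM); apply/eqP; rewrite eq_mulgV1.
  by rewrite -(homV cosetM) -cosetM -cX coset_id ?cycle_id.
rewrite -!(homV cosetM) -!cosetM; congr coset; congr pair.
  exact: second_rel.
by rewrite /= !invg1 !mul1g !mulg1 mulgV mulVg.
Qed.

Lemma twist_der_neq1 k : 0 < k -> [set: S]^`(k) != 1 -> Gt^`(k) != 1.
Proof.
case: k => // k _; apply: contra_neq => triv.
rewrite -fstE -morphim_der ?subsetT // derE_sub_C ?morphim1 //.
by rewrite -quotient_sub1 // quotient_der // triv.
Qed.

Lemma twist_model : exists (gT : finGroupType) (a b : gT),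
  [/\ [/\ 3.-group [set: gT], <<[set a; b]>> = [set: gT] & Gn_relations n a b],
      #|[set: S]| <= #|[set: gT]| &
      forall k, 0 < k -> [set: S]^`(k) != 1 -> [set: gT]^`(k) != 1].
Proof.
have [Ga Gb] : coset C X \in Gt /\ coset C Y \in Gt.
  by split; apply: mem_quotient.
exists (subg_of Gt), (subg Gt (coset C X)), (subg Gt (coset C Y)); split.
- split; first by rewrite pgroup_subg twist_pgroup.
    by rewrite -subg_set2; apply: subg_gen twist_gen.
  apply: (@Gn_relations_inj _ _ (@sgval _ Gt)) => //; first exact: subg_inj.
  by rewrite !subgK //; apply: twist_relations.
- by rewrite card_subg_type; apply: twist_card.
by move=> k k_gt0 /(twist_der_neq1 k_gt0); apply: subg_der_neq1.
Qed.

End CentralTwist.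

Lemma finite_model n : 0 < n -> exists (gT : finGroupType) (x y : gT),
  [/\ [/\ 3.-group [set: gT], <<[set x; y]>> = [set: gT] & Gn_relations n x y],
      #|[set: gT]| = (3 ^ (3 * n + 2))%N,
      nil_class [set: gT] = (2 * n + 1)%N &
      has_derived_length [set: gT] (trunc_log 2 (3 * n + 3))].
Proof.
move=> n_gt0; have nil3 := three_nil_Zexp3 n.
have cardS := card_iwahori_Zexp3 n.
have [theta theta1 theta_sqr] := sqrt_neg_half nil3.
have pS : 3.-group [set: iwahori (3%R : 'Z_(3 ^ n.+1))].
  by rewrite /pgroup cardS pnatX.
have genS := gen_iwahori nil3 theta1 theta_sqr (@residue_Zexp3 n) pS.
have [gT [x [y [[pG genG rel_xy] leSG derG]]]] := twist_model pS genS
  (iwahori_x_cube _) (iwahori_y_pow_central nil3 theta1 theta_sqr)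
  (iwahori_y_pow_cube nil3 theta1 theta_sqr)
  (iwahori_second_relation theta1 theta_sqr).
have cardG : #|[set: gT]| = (3 ^ (3 * n + 2))%N.
  apply/eqP; rewrite eqn_leq -{2}cardS leSG andbT.
  exact: card_Gn_leq pG genG n_gt0 rel_xy.
exists gT, x, y; split=> //.
  exact: nil_class_Gn pG genG n_gt0 rel_xy cardG.
apply: derived_length_Gn pG genG n_gt0 rel_xy cardG _ => d d_gt0 lt_d.
apply: derG => //.
apply: iwahori_der_neq1 nil3 (unitr2_three_nil nil3) _ _ _ => //.
exact: three_exp_neq0_Zexp3.
Qed.

(** * Pro-p groups *)

Local Open Scope card_scope.

Section AbstractQuotients.
Variable G : groupType.
Implicit Types (N : normal_subgroup G) (A : set G).

Lemma hom_ker_normal (H : groupType) (f : G -> H) :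
  {morph f : u v / u * v} -> is_normal_subgroup [set u | f u = 1]%classic.
Proof.
move=> fM; split; first split.
- exact: hom1.
- by move=> u v /= fu fv; rewrite fM fu fv mulg1.
- by move=> u /= fu; rewrite (homV fM) fu invg1.
by move=> u g /= fu; rewrite /conjg !fM (homV fM) fu mul1g mulVg.
Qed.

Lemma first_isomorphism N (H : groupType) (f : G -> H) :
    {morph f : u v / u * v} -> (forall h, exists u, f u = h) ->
    (forall u, normal_set N u <-> f u = 1) ->
  exists g : quotient_group N -> H, bijective g /\ {morph g : a b / a * b}.
Proof.
move=> fM /choice[s sK] kerf.
pose rep (a : quotient_group N) : G := generic_quotient.repr a.
pose cls u : quotient_group N := \pi_(quotient_group N)%qT u.
have f_rep u : f (rep (cls u)) = f u.
  by apply/esym/(hom_eqP fM)/kerf/quot_repr.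
have rep_cls a : cls (rep a) = a by apply: reprK.
exists (f \o rep); split=> [|a b /=].
  exists (cls \o s) => [a|h] /=; last by rewrite f_rep sK.
  by rewrite -[RHS]rep_cls; apply/quot_eqP/kerf/(hom_eqP fM)/sK.
by rewrite -fM -(f_rep (rep a * rep b)).
Qed.

Lemma card_quotient_group N :
  [set: quotient_group N]%classic #= left_cosets (normal_set N).
Proof.
have [[N1 NM NV] _] := normal_setP N.
pose rep (a : quotient_group N) : G := generic_quotient.repr a.
have coset_eq u v : normal_set N (u^-1 * v) ->
    ([set v * a | a in normal_set N] `<=`
     [set u * a | a in normal_set N])%classic.
  move=> Nuv _ [a Na <-]; exists (u^-1 * v * a); first exact: NM.
  by rewrite !mulgA mulgV mul1g.
pose f a := [set rep a * v | v in normal_set N]%classic.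
have -> : left_cosets (normal_set N) = range f.
  apply/seteqP; split=> [_ [u _ <-]|_ [a _ <-]]; last by exists (rep a).
  exists (\pi_(quotient_group N)%qT u) => //; have Nu := quot_repr N u.
  apply/seteqP; split; apply: coset_eq => //.
  by have := NV _ Nu; rewrite invgM invgK.
apply/card_esym/inj_card_eq => a b _ _ /seteqP[_ /(_ (rep b))].
case=> [|v Nv Db]; first by exists 1; rewrite ?mulg1.
rewrite -[a]reprK -[b]reprK; apply/quot_eqP.
by rewrite -[generic_quotient.repr b]/(rep b) -Db mulKg.
Qed.

Lemma finite_quotient_group N m : left_cosets (normal_set N) #= `I_m ->
  exists (gT : finGroupType) (f : G -> gT),
    [/\ {morph f : u v / u * v}, forall u, f u = 1 <-> normal_set N u &
        #|[set: gT]| = m].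
Proof.
move=> /(card_eq_trans (card_quotient_group N))/card_set_bijP.
move=> [f [f_lt f_inj f_surj]].
pose Q := quotient_group N.
have lt_f (a : Q) : f a < m by apply: f_lt.
pose fo a := Ordinal (lt_f a).
have fo_inj : injective fo by move=> a b [eq_f]; apply: f_inj; rewrite ?in_setE.
have /choice[g foK] : forall i, exists a, fo a = i.
  by move=> i; have [a _ Da] := f_surj i (ltn_ord i); exists a; apply: val_inj.
have gK : cancel fo g by move=> a; apply: fo_inj; rewrite foK.
pose countQ : countType := HB.pack Q (@CanIsCountable 'I_m Q fo g gK).
pose gT : finGroupType := HB.pack Q countQ (@CanIsFinite countQ 'I_m fo g gK).
exists gT, (fun u => \pi_Q%qT u); split.
- exact: pi_mulg.
- move=> u; rewrite -[1]/(\pi_Q%qT 1).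
  split=> [/esym/quot_eqP|Nu]; first by rewrite invg1 mul1g.
  by apply/esym/quot_eqP; rewrite invg1 mul1g.
rewrite cardsT -[RHS]card_ord; apply: (@bij_eq_card gT _ fo).
by exists g.
Qed.

End AbstractQuotients.

Definition discrete_group (gT : finGroupType) : Type := gT.

Section DiscreteGroup.
Variable gT : finGroupType.
HB.instance Definition _ := monoid.Group.copy (discrete_group gT) gT.
HB.instance Definition _ := hasNbhs.Build (discrete_group gT) principal_filter.
HB.instance Definition _ := Discrete_ofNbhs.Build (discrete_group gT) erefl.

Lemma discrete_continuous (T : topologicalType) (f : discrete_group gT -> T) :
  continuous f.
Proof.
move=> u A /nbhs_singleton Afu; rewrite nbhs_simpl /=.
apply: (@filterS _ (nbhs u) _ [set u]%classic); first by move=> _ ->.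
exact: discrete_set1.
Qed.

Fact discrete_mulg_continuous :
  continuous (fun z : discrete_group gT * discrete_group gT => z.1 * z.2).
Proof.
move=> [u v] A /nbhs_singleton /= Auv.
exists ([set u], [set v])%classic; first by split; apply: discrete_set1.
by move=> [u' v'] /= [-> ->].
Qed.

HB.instance Definition _ := isTopGroup.Build (discrete_group gT)
  discrete_mulg_continuous (@discrete_continuous _ _).

Lemma discrete_profinite : profinite (discrete_group gT).
Proof.
split; first exact/finite_compact/(@finite_finset gT).
  exact: discrete_hausdorff.
move=> B /nbhs_singleton B1; exists [set 1]%classic; split.
- exact: discrete_open.
- split=> [//|u v -> ->|u ->]; first by rewrite /= mulg1.
  by rewrite /= invg1.
- by move=> _ ->.
Qed.

Lemma card_left_cosets (U : {group gT}) :
  left_cosets ([set` U] : set gT)%classic #= `I_#|[set: gT] : U|.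
Proof.
rewrite -card_lcosets; set L := lcosets U [set: gT].
pose f (i : 'I_#|L|) : set gT := [set` enum_val i]%classic.
have lcosetE g : ([set g * u | u in [set` U]] = [set` g *: U])%classic.
  apply/seteqP; split=> [_ [u Uu <-]|_ /lcosetP[u Uu ->]]; last by exists u.
  by apply/lcosetP; exists u.
have -> : left_cosets ([set` U] : set gT)%classic = range f.
  apply/seteqP; split=> [_ [g _ <-]|_ [i _ <-]].
    have Lg : g *: U \in L by apply/lcosetsP; exists g; rewrite ?inE.
    by exists (enum_rank_in Lg (g *: U)); rewrite // /f enum_rankK_in ?lcosetE.
  by have /lcosetsP[g _ Di] := enum_valP i; exists g; rewrite // /f Di lcosetE.
apply: card_eq_trans (card_esym card_II); apply: inj_card_eq => i j _ _ eq_f.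
apply/enum_val_inj/setP=> u; have /seteqP[sij sji] := eq_f.
by apply/idP/idP; [apply: sij | apply: sji].
Qed.

Lemma discrete_pro_p p :
  prime p -> p.-group [set: gT] -> pro_p p (discrete_group gT).
Proof.
move=> p_pr pG; split; first exact: discrete_profinite.
move=> U _ [[U1 UM UV] _].
have grU : group_set [set u : gT | `[< U u >]].
  apply/group_setP; split=> [|u v]; rewrite !in_set; first exact/asboolP.
  by move=> /asboolP Uu /asboolP Uv; apply/asboolP/UM.
have -> : U = ([set` Group grU] : set gT)%classic.
  by apply/seteqP; split=> u; rewrite /= in_set; move/asboolP.
have [k Dk] := p_natP (pnat_dvd (dvdn_indexg [set: gT]%G (Group grU)) pG).
by exists k; rewrite -Dk; apply: card_left_cosets.
Qed.

End DiscreteGroup.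

Lemma normal_mul_subgroup (G : groupType) (N W : set G) :
    is_normal_subgroup N -> is_normal_subgroup W ->
  is_normal_subgroup [set v | exists2 a, N a & W (a^-1 * v)]%classic.
Proof.
move=> [[N1 NM NV] NJ] [[W1 WM WV] WJ]; split; first split.
- by exists 1; rewrite // mulg1 invg1.
- move=> u v [a Na Wa] [b Nb Wb].
  exists (a * (b ^ (a^-1 * u)^-1)); first by apply: NM => //; apply: NJ.
  have -> : (a * b ^ (a^-1 * u)^-1)^-1 * (u * v) = (a^-1 * u) * (b^-1 * v).
    by rewrite /conjg !gnorm.
  exact: WM.
- move=> u [a Na Wa]; exists (a^-1 ^ u); first by apply/NJ/NV.
  have -> : (a^-1 ^ u)^-1 * u^-1 = (a^-1 * u)^-1 by rewrite /conjg !gnorm.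
  exact: WV.
move=> u g [a Na Wa]; exists (a ^ g); first exact: NJ.
by rewrite -conjVg -conjMg; apply: WJ.
Qed.

Section TopGroup.
Variable G : topGroupType.
Implicit Types (A N U V W : set G) (g u v : G).

Lemma mulgl_continuous g : continuous (fun u : G => g * u).
Proof.
move=> u; have pair_continuous : {for u, continuous (fun v : G => (g, v))}.
  by apply: cvg_pair; [apply: cst_continuous | apply: cvg_id].
exact: continuous_comp pair_continuous (mulg_continuous (g, u)).
Qed.

Lemma conjg_continuous : continuous (fun z : G * G => z.1 ^ z.2).
Proof.
move=> [u g].
have inv_snd : {for (u, g), continuous (fun z : G * G => z.2^-1)}.
  by apply: continuous_comp (invg_continuous g); apply: cvg_snd.
have factors : {for (u, g), continuous (fun z : G * G => (z.2^-1, z.1 * z.2))}.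
  exact: cvg_pair inv_snd (mulg_continuous (u, g)).
exact: (continuous_comp factors (mulg_continuous (g^-1, u * g))).
Qed.

Lemma subgroup_coset_nbhs U u : is_subgroup U -> open U ->
  \forall v \near u, U (u^-1 * v).
Proof.
move=> [U1 _ _] oU; apply: (mulgl_continuous (g := u^-1) (x := u)).
by rewrite mulVg; apply: open_nbhs_nbhs.
Qed.

Lemma subgroup_open U : is_subgroup U -> nbhs (1 : G) U -> open U.
Proof.
move=> [U1 UM UV] nU; rewrite openE => u Uu.
have : nbhs (u^-1 * u) U by rewrite mulVg.
move=> /(mulgl_continuous (g := u^-1)); rewrite /interior nbhs_simpl /=.
apply: filterS => v /= Uv; rewrite -[v](mulKVg u); exact: UM.
Qed.

Lemma open_normal_core U :
    compact [set: G]%classic -> open U -> is_subgroup U ->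
  exists W : set G, [/\ open W, is_normal_subgroup W & (W `<=` U)%classic].
Proof.
move=> cG oU sU; have [U1 UM UV] := sU.
pose W : set G := [set u | forall g, U (u ^ g)]%classic.
have sW : is_subgroup W.
  split=> [g|u v Wu Wv g|u Wu g]; first by rewrite conj1g.
    by rewrite conjMg; apply: UM.
  by rewrite conjVg; apply: UV.
exists W; split; last by move=> u /(_ 1); rewrite conjg1.
  apply: subgroup_open => //.
  have /compact_near_coveringP near_cov := cG.
  have : \forall u \near (1 : G), ([set: G] `<=` (fun g => U (u ^ g)))%classic.
    apply: (near_cov G (nbhs (1 : G)) (fun u g => U (u ^ g))) => g _.
    have nU : nbhs ((1 : G) ^ g) U by rewrite conj1g; apply: open_nbhs_nbhs.
    have [[A B] /= [nA nB] sAB] := conjg_continuous (x := (1, g)) nU.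
    exists (B, A) => //= -[g' u] /= [Bg' Au]; exact: (sAB (u, g')).
  by apply: filterS => u Uu g; apply: Uu.
by split=> // u g Wu h; rewrite -conjgM.
Qed.

Lemma closed_normal_separation N g : profinite G -> closed N ->
    is_normal_subgroup N -> ~ N g ->
  exists V : set G,
    [/\ open V, is_normal_subgroup V, (N `<=` V)%classic & ~ V g].
Proof.
move=> [cG _ smallG] cN nN Ng; have [[N1 _ _] _] := nN.
have nB : nbhs (1 : G) [set u | ~ N (g * u)]%classic.
  have nNg : nbhs (g * 1) (~` N)%classic.
    by rewrite mulg1; apply: open_nbhs_nbhs; split=> //; apply: closed_openC.
  exact: mulgl_continuous nNg.
have [U [oU sU UB]] := smallG _ nB.
have [W [oW nW WU]] := open_normal_core cG oU sU.
have [[W1 WM WV] WJ] := nW; have nV := normal_mul_subgroup nN nW.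
exists [set v | exists2 a, N a & W (a^-1 * v)]%classic; split=> //.
- apply: subgroup_open nV.1 _; apply: (filterS (P := W)).
    by move=> w Ww; exists 1; rewrite // invg1 mul1g.
  exact: open_nbhs_nbhs.
- by move=> a Na; exists a; rewrite // mulVg.
case=> a Na Wa; apply: (UB _ (WU _ (WV _ Wa))).
by rewrite /= invgM invgK mulKVg.
Qed.

Lemma finite_quotient V m :
    open V -> is_normal_subgroup V -> left_cosets V #= `I_m ->
  exists (gT : finGroupType) (f : G -> discrete_group gT),
    [/\ topgroup_hom f, forall u, f u = 1 <-> V u & #|[set: gT]| = m].
Proof.
move=> oV nV cV.
have [gT [f [fM kerf cardG]]] :=
  @finite_quotient_group _ (NormalSubgroup nV) m cV.
exists gT, f; split=> //; split=> // u A /nbhs_singleton Au.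
rewrite nbhs_simpl /=.
apply: filterS (subgroup_coset_nbhs u nV.1 oV) => v Vuv.
by rewrite /= -[f v](iffRL (hom_eqP fM u v)) ?kerf.
Qed.

End TopGroup.

Lemma hom_surj_gen (G : groupType) (gT : finGroupType) (f : G -> gT)
    (A : {set gT}) :
    {morph f : u v / u * v} -> <<A>> = [set: gT] ->
    {in A, forall a, exists u, f u = a} ->
  forall c, exists u, f u = c.
Proof.
move=> fM genA surjA c.
have grI : group_set [set c : gT | `[< exists u, f u = c >]].
  apply/group_setP; split=> [|a b]; rewrite !in_set.
    by apply/asboolP; exists 1; apply: (hom1 fM).
  move=> /asboolP[u <-] /asboolP[v <-].
  by apply/asboolP; exists (u * v); apply: fM.
have sAI : <<A>> \subset Group grI.
  rewrite gen_subG; apply/subsetP=> a /surjA surj_a.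
  by rewrite in_set; apply/asboolP.
by have := subsetP sAI c; rewrite genA !in_set => /(_ isT)/asboolP.
Qed.

Lemma free_pro_p2_hom_ext p (F H : topGroupType) (x y : F) (f g : F -> H) :
    free_pro_p2 p x y -> pro_p p H -> topgroup_hom f -> topgroup_hom g ->
  f x = g x -> f y = g y -> f = g.
Proof.
move=> [_ univ] proH hf hg fx fy.
have [h [_ h_uniq]] := univ H proH (g x) (g y).
by rewrite -(h_uniq f) ?(h_uniq g).
Qed.

Section PresentedGroup.
Variables (p : nat) (G : topGroupType) (R : set G).
Hypotheses (p_pr : prime p) (proG : pro_p p G).
Local Notation N := (closed_normal_gen R).

Lemma mem_closed_normal_gen u :
    (forall (rT : finGroupType) (g : G -> discrete_group rT),
       p.-group [set: rT] -> topgroup_hom g ->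
       (R `<=` [set v | g v = 1])%classic -> g u = 1) ->
  N u.
Proof.
move=> triv_u; apply: contrapT => notNu.
have closedN : closed N by apply: closed_bigI => A [].
have [V [oV nV NV notVu]] :=
  closed_normal_separation proG.1 closedN (closed_normal_genP R) notNu.
have [k cV] := proG.2 V oV nV.
have [rT [g [hom_g kerg cardR]]] := finite_quotient oV nV cV.
apply/notVu/kerg/triv_u => // [|v Rv /=].
  by rewrite /pgroup cardR pnatX pnat_id.
by apply/kerg/NV => A [_ _]; apply.
Qed.

Lemma closed_normal_gen_sub_ker (gT : finGroupType)
    (f : G -> discrete_group gT) :
    topgroup_hom f -> (R `<=` [set u | f u = 1])%classic ->
  forall u, N u -> f u = 1.
Proof.
move=> [fM f_cont] Rf u /(_ [set v | f v = 1]%classic); apply; split=> //.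
  apply: (@preimage_closed _ _ f [set 1]%classic) => [v _|].
    exact: f_cont.
  exact: discrete_closed.
exact: hom_ker_normal.
Qed.

(* The closed normal subgroup generated by [R] is the intersection of the open
normal subgroups containing it, so the presented group is determined by its
finite p-quotients. *)
Lemma presented_group_finite (gT : finGroupType) (f : G -> discrete_group gT) :
    topgroup_hom f -> (forall c, exists u, f u = c) ->
    (R `<=` [set u | f u = 1])%classic ->
    (forall (rT : finGroupType) (g : G -> discrete_group rT),
       p.-group [set: rT] -> topgroup_hom g ->
       (R `<=` [set v | g v = 1])%classic -> forall u, f u = 1 -> g u = 1) ->
  exists h : presented_group R -> gT, bijective h /\ {morph h : a b / a * b}.
Proof.
move=> hom_f f_surj Rf f_univ.
apply: first_isomorphism hom_f.1 f_surj _ => u; split.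
  exact: closed_normal_gen_sub_ker.
move=> fu; apply: mem_closed_normal_gen => rT g pR hom_g Rg.
exact: f_univ pR hom_g Rg u fu.
Qed.

End PresentedGroup.

Lemma relators_sub_ker (F : topGroupType) (x y : F) (sigma : F -> F) n
    (gT : finGroupType) (f : F -> gT) :
    {morph sigma : u v / u * v} -> sigma x = x^-1 -> sigma y = y^-1 ->
    {morph f : u v / u * v} -> 3.-group [set: gT] ->
  (relators x y sigma n `<=` [set u | f u = 1])%classic <->
  Gn_relations n (f x) (f y).
Proof.
move=> sM sx sy fM pG.
have sigma_r : sigma (rword x y n) = x ^- 3 * y ^+ (3 ^ n).
  by rewrite /rword sM (homV sM) !(homX sM) sx sy !expgVn invgK.
have sigma_t : sigma (tword x y) = y^-1 * x^-1 * y^-1 * x * y^-1.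
  by rewrite /tword !sM (homV sM) sx sy invgK.
have f_r : f (rword x y n) = f x ^+ 3 * f y ^- (3 ^ n).
  by rewrite /rword !(fM, homV fM, homX fM).
have f_t : f (tword x y) = f y * f x * f y * (f x)^-1 * f y.
  by rewrite /tword !(fM, homV fM).
have rel_r : f (rword x y n) = f (sigma (rword x y n)) <->
    f x ^+ 3 = f y ^+ (3 ^ n).
  rewrite sigma_r f_r fM (homV fM) !(homX fM).
  split=> [eq_r|->]; last by rewrite mulgV mulVg.
  apply: (odd_sqr_inj (odd_pgroup_odd _ pG)); rewrite ?inE //.
  apply: (mulgI (f x ^- 3)); apply: (mulIg (f y ^- (3 ^ n))).
  by rewrite [(f x ^+ 3) ^+ 2]expgS [(f y ^+ (3 ^ n)) ^+ 2]expgS !expg1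
    mulKg eq_r mulgA mulgK.
split=> [sub|[rel_x rel_t] u].
  have /(hom_eqP fM) eq_r := sub _ (or_introl erefl).
  have /(hom_eqP fM) eq_t := sub _ (or_intror erefl).
  split; first exact/rel_r.
  by move: eq_t; rewrite sigma_t f_t !(fM, homV fM).
case=> ->; apply/(hom_eqP fM); first exact/rel_r.
by rewrite sigma_t f_t rel_t !(fM, homV fM).
Qed.

Theorem theorem1 (F : topGroupType) (x y : F) (sigma : F -> F)
    (hF : free_pro_p2 3 x y)
    (hsigma : topgroup_aut sigma)
    (hx : sigma x = x^-1) (hy : sigma y = y^-1)
    (n : nat) (hn : (1 <= n)%N) :
  exists (gT : finGroupType)
         (f : presented_group (relators x y sigma n) -> gT),
    [/\ bijective f, {morph f : u v / u * v},
        [/\ 3.-group [set: gT] & #|[set: gT]| = (3 ^ (3 * n + 2))%N],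
        [/\ nilpotent [set: gT] & nil_class [set: gT] = (2 * n + 1)%N] &
        has_derived_length [set: gT] (trunc_log 2 (3 * n + 3))].
Proof.
have [[sigmaM _] _] := hsigma; have [proF univ] := hF.
have [gT [a [b [[pG genG rel_ab] cardG classG derG]]]] := finite_model hn.
have pro_discrete := fun rT => @discrete_pro_p rT 3 (isT : prime 3).
have [f [[hom_f fx fy] _]] := univ _ (pro_discrete gT pG) a b.
have sub_ker (rT : finGroupType) (g : F -> discrete_group rT)
    (hom_g : topgroup_hom g) :=
  @relators_sub_ker F x y sigma n rT g sigmaM hx hy hom_g.1.
have f_surj : forall c, exists u, f u = c.
  apply: hom_surj_gen hom_f.1 genG _ => _ /set2P[]->; first by exists x.
  by exists y.
have [||h [bij_h hM]] := @presented_group_finite 3 F (relators x y sigma n)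
  isT proF gT f hom_f f_surj.
- by apply/(sub_ker _ f hom_f pG); rewrite fx fy.
- move=> rT g pR hom_g /(sub_ker _ _ hom_g pR) rel_g u fu.
  have [k [kM kx ky]] := Gn_von_dyck hn pG genG cardG rel_ab pR rel_g.
  have hom_kf : topgroup_hom (k \o f : F -> discrete_group rT).
    split=> [v w /=|v]; first by rewrite hom_f.1; apply: kM.
    by apply: continuous_comp (hom_f.2 v) _; apply: discrete_continuous.
  have eq_g := free_pro_p2_hom_ext hF (pro_discrete rT pR) hom_g hom_kf.
  by rewrite eq_g /= ?fx ?fy // fu (hom1 kM).
by exists gT, h; split=> //; split=> //; apply: pgroup_nil pG.
Qed.
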